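(* Let $G$ be a connected $K_{1,5}$-free graph with $n$ vertices. If $\sigma_5(G)\geq n-1$, then $G$ contains a spanning tree with at most $4$ leaves.
   Context: All graphs are finite and simple. For a vertex $v$, $d(v)$ denotes its degree in $G$. For $k\geq 1$, $\sigma_k(G)=\min\{\sum_{i=1}^k d(v_i) : \{v_1,\ldots,v_k\}$ is an independent set of $k$ vertices in $G\}$. A graph is $K_{1,r}$-free if it does not contain $K_{1,r}$ as an induced subgraph. A leaf of a tree is a vertex of degree one in the tree. *)

(* Defs.v *)
From mathcomp Require Import all_boot.
Set Implicit Arguments. Unset Strict Implicit. Unset Printing Implicit Defensive.

Definition simple_graph (T : finType) (e : rel T) : Prop :=
  symmetric e /\ irreflexive e.

Definition deg (T : finType) (e : rel T) (v : T) : nat := #|[set u | e v u]|.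

Definition connected_graph (T : finType) (e : rel T) : Prop :=
  forall x y : T, connect e x y.

Definition independent (T : finType) (e : rel T) (S : {set T}) : Prop :=
  forall x y, x \in S -> y \in S -> ~~ e x y.

Definition has_induced_star (T : finType) (e : rel T) (r : nat) : Prop :=
  exists (v : T) (S : {set T}),
    #|S| = r /\ (forall u, u \in S -> e v u) /\ independent e S.

Definition star_free (T : finType) (e : rel T) (r : nat) : Prop :=
  ~ has_induced_star e r.

(* sigma_k(G) >= m : every independent set of k vertices has degree sum >= m
   (vacuous if there is no independent k-set, i.e. sigma_k = +infinity). *)
Definition sigma_ge (T : finType) (e : rel T) (k m : nat) : Prop :=
  forall S : {set T}, #|S| = k -> independent e S -> m <= \sum_(v in S) deg e v.

Definition edge_rel (T : finType) (F : {set {set T}}) : rel T :=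
  fun x y => (x != y) && ([set x; y] \in F).

Definition subgraph_edges (T : finType) (e : rel T) (F : {set {set T}}) : Prop :=
  forall E, E \in F -> exists x y, x != y /\ e x y /\ E = [set x; y].

(* A spanning tree of G: a set of edges of G forming a connected graph on all
   vertices that is acyclic, i.e. minimally connected: deleting any edge
   disconnects its endpoints. *)
Definition spanning_tree (T : finType) (e : rel T) (F : {set {set T}}) : Prop :=
  subgraph_edges e F /\ connected_graph (edge_rel F) /\
  (forall x y, [set x; y] \in F -> x != y ->
     ~~ connect (edge_rel (F :\ [set x; y])) x y).

Definition leaves (T : finType) (F : {set {set T}}) : {set T} :=
  [set v | deg (edge_rel F) v == 1].

(* Main.v *)
Require Import Defs.
From mathcomp Require Import all_boot zify.
From Stdlib Require Import Classical.
Set Implicit Arguments.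
Unset Strict Implicit.
Unset Printing Implicit Defensive.

(** Suppose there is no spanning tree with at most four leaves.  Take a largest
    subtree made of a core path carrying five legs, two at each end of the core
    and one at some vertex of it (legs may share anchors or be empty), and among
    these one with the longest core.  By maximality no leg is empty (a tree with
    an empty leg has at most four leaves and, not being spanning, could be
    grown), so exchanging edges inside the vertex set of the subtree can never
    empty a leg or lengthen the core.  Hence the five leaves are independent,
    all their neighbours lie in the subtree, and the edges from the leaves to a
    leg of size k number less than k.  The same exchanges together with
    K_{1,5}-freeness bound the edges to the core by its size plus 3.  Altogether
    the degrees of the five leaves sum to at most (size of subtree) - 2, against
    sigma_5 >= |V| - 1. *)

(** K_{1,5}-freeness alone is too weak on the core: a star at an inner core vertex that contains its
    two core neighbours still has room for two leaves, which only gives about twice the size of the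
    core. Averaging removes the factor two. A chord from a core vertex to a leaf can replace a core
    edge; the segment of the core cut off in this way becomes a leg, and its vertex next to the
    chord becomes a leaf of an equally large frame, so it sees no leaf at all. Vertices seeing two
    leaves are paid for by such vertices. The excess 3 over the size of the core has different
    sources. If the third anchor is inner, each end of the core and this anchor contribute one. If
    three legs meet at an end, the two ends share the excess. If the core is a single vertex, it
    sees at most 4 = 1 + 3 leaves. The longest core serves to exclude a leaf adjacent to two
    consecutive core vertices and most edges between different legs. *)

Lemma first_split (T : Type) (p : pred T) C : has p C ->
  exists D x b, [/\ C = D ++ x :: b, p x & ~~ has p D].
Proof.
elim: C => //= x C IH; case px: (p x); first by exists [::], x, C.
case/IH=> D [y [b [-> py DN]]].
by exists (x :: D), y, b; rewrite /= px.
Qed.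

(** * Averaging leaf counts along a segment of the core *)

Section Segments.

Variables (T : eqType) (nu : T -> nat).

(* nu counts the leaves adjacent to a vertex; spaced says that a vertex seeing
   two of them is preceded by one seeing none, so nu averages at most 1. *)
Definition spaced : rel T := fun y z => (nu z <= 1) || (nu z <= 2) && (nu y == 0).

Lemma path_spaced y D :
  (forall a x z b, y :: D = a ++ x :: z :: b -> spaced x z) -> path spaced y D.
Proof.
elim: D y => //= z D IH y step; rewrite (step [::] y z D) //=.
by apply: IH => a x x' b zD; apply: (step (y :: a) x x' b); rewrite zD.
Qed.

(** The indicator [nu y == 0] is a credit: a vertex seeing no leaf earns one unit, and a following
    vertex seeing two spends it. Credit unspent at the end stays on the left, where [sum_after] uses
    it. *)
Lemma sum_spaced y D : path spaced y D ->
  sumn [seq nu x | x <- D] + (nu (last y D) == 0) <= size D + (nu y == 0).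
Proof.
elim: D y => [|z D IH] y //= /andP[yz /IH {IH}].
by move: yz; rewrite /spaced; do !case: eqP => /=; lia.
Qed.

(* lam counts the leaves at the near end s of the segment, rho all the others. *)
Variables lam rho : T -> nat.
Hypothesis nuE : forall x, nu x = lam x + rho x.

Variables (s : T) (C : seq T).
Hypothesis lam_pred : forall a z b, C = a ++ z :: b -> 0 < lam z ->
  exists a' y, a = rcons a' y /\ nu y = 0.
Hypothesis nu_le2 : {in C, forall x, nu x <= 2}.

(** By [lam_pred] the first vertex of [D], having no predecessor in [C], sees nothing; it provides
    the initial credit. *)
Lemma sum_near D E : C = D ++ E -> {in D, forall x, rho x = 0} ->
  sumn [seq nu x | x <- D] <= size D.
Proof.
case: D => // x D CE rho0.
have nux : nu x = 0.
  rewrite nuE rho0 ?mem_head // addn0; apply/eqP; rewrite -leqn0 leqNgt; apply/negP.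
  by case/(lam_pred (a := [::]) CE) => -[|? ?] [? []].
have /sum_spaced : path spaced x D.
  apply: path_spaced => a y z b xD; rewrite /spaced.
  have CE' : C = rcons a y ++ z :: (b ++ E) by rewrite CE xD cat_rcons -catA.
  have -> /= : nu z <= 2 by apply: nu_le2; rewrite CE' mem_cat mem_head orbT.
  case: leqP => //= z2; case: (lam_pred CE').
    by move: z2; rewrite nuE rho0 ?xD ?mem_cat ?inE ?eqxx ?orbT //; lia.
  by move=> a' [y' [/rcons_inj[_ ->] ->]].
by rewrite nux /=; lia.
Qed.

Hypothesis rho_next : forall d y b, s :: C = d ++ y :: b -> 0 < rho y ->
  exists z b', b = z :: b' /\ nu z = 0.
Hypothesis rho_lam_next : forall d x b y z b', s :: C = d ++ x :: b ++ y :: z :: b' ->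
  0 < rho x -> 0 < lam y -> rho z <= 1.
Hypothesis lam_last : forall d x b y, s :: C = d ++ x :: rcons b y -> 0 < rho x -> lam y = 0.

(** Beyond [x] the segment starts and ends with a vertex seeing no leaf, so one credit is never
    spent; hence the strict inequality. *)
Lemma sum_after d x b : s :: C = d ++ x :: b -> 0 < rho x ->
  sumn [seq nu y | y <- b] < size b.
Proof.
move=> CE rx; have [z [b' [bE nuz]]] := rho_next CE rx; rewrite {b}bE in CE *.
have inC y : y \in b' -> y \in C.
  move=> yb; case: d CE => [|s' d] [_ ->]; first by rewrite inE yb orbT.
  by rewrite mem_cat !inE yb !orbT.
have /sum_spaced : path spaced z b'.
  apply: path_spaced => a y z' c zb; rewrite /spaced.
  have zC : z' \in b'.
    by case: a zb => [|? a] [_ ->]; rewrite ?mem_head // mem_cat !inE eqxx !orbT.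
  rewrite (nu_le2 (inC _ zC)) /=; case: leqP => //= z2.
  have CEy : s :: C = (d ++ x :: a) ++ y :: z' :: c by rewrite CE zb -catA.
  (* If [lam z'] vanishes, both leaves seen by [z'] count in [rho], and [rho_next] and
     [rho_lam_next] exclude any leaf at its predecessor. *)
  have [lz|lz] := posnP (lam z').
    have ry : rho y = 0.
      have [//|ry] := posnP (rho y); have [z0 [c' [[<- _] z0']]] := rho_next CEy ry.
      by rewrite z0' in z2.
    have ly : lam y = 0.
      have [//|ly] := posnP (lam y); have := rho_lam_next (b := a) (b' := c) _ rx ly (z := z').
      by rewrite -catA in CEy; move=> /(_ d CEy); rewrite nuE lz in z2; lia.
    by rewrite nuE ly ry.
  have [d' CE'] : exists d', C = rcons d' y ++ z' :: c.
    by case: (d) CEy => [|s' d0] [_ CEy]; [exists a | exists (d0 ++ x :: a)];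
      rewrite cat_rcons.
  by have [a' [y' [/rcons_inj[_ ->] ->]]] := lam_pred CE' lz.
have lastz : nu (last z b') = 0.
  have CEl : s :: C = (d ++ x :: belast z b') ++ last z b' :: [::].
    by rewrite CE -catA /= cats1 -lastI.
  have r0 : rho (last z b') = 0.
    by have [//|rl] := posnP (rho (last z b')); have [? [? []]] := rho_next CEl rl.
  by rewrite nuE r0 (lam_last (d := d) (x := x) (b := belast z b')) // -lastI.
by rewrite lastz /= nuz; lia.
Qed.

(** Cut at the first [x] with [rho x] positive: its excess of at most one is absorbed by the strict
    bound of [sum_after]. If [s] itself has positive [rho], that spare unit is the extra term on the
    left. *)
Lemma segment_sum : sumn [seq nu x | x <- C] + (0 < rho s) <= size C.
Proof.
case: (posnP (rho s)) => [rs|rs]; last first.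
  by have := sum_after (d := [::]) erefl rs; lia.
rewrite addn0.
have [rC|/allPn] := boolP (all (fun x => rho x == 0) C).
  by apply: (sum_near (E := [::])); rewrite ?cats0 // => x xC; apply/eqP/(allP rC).
move=> nall; have /first_split[D [x [b [CE rx DN]]]] : has (fun x => 0 < rho x) C.
  by apply/hasP; case: nall => x xC; rewrite -lt0n; exists x.
have := sum_after (d := s :: D) (x := x) (b := b); rewrite CE => /(_ erefl rx) sb.
have sD : sumn [seq nu y | y <- D] <= size D.
  apply: (sum_near CE) => y yD; apply/eqP; rewrite -leqn0 leqNgt.
  by apply: contra DN => ry; apply/hasP; exists y.
have nux : nu x <= 2 by apply: nu_le2; rewrite CE mem_cat mem_head orbT.
by rewrite map_cat sumn_cat size_cat /=; lia.
Qed.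

End Segments.

(** * Building a subtree by attaching paths *)

Section Grow.

Variables (T : finType) (e : rel T).
Hypotheses (e_sym : symmetric e) (e_irr : irreflexive e).

Implicit Types (F : {set {set T}}) (S : {set T}).

Lemma edge_rel_sym F : symmetric (edge_rel F).
Proof. by move=> x y; rewrite /edge_rel eq_sym setUC. Qed.

Lemma edge_rel_sub F F' : F \subset F' -> subrel (edge_rel F) (edge_rel F').
Proof. by move=> /subsetP FF x y /andP[xy /FF xyF]; apply/andP. Qed.

Lemma connect_sub_edges F F' x y : F \subset F' ->
  connect (edge_rel F) x y -> connect (edge_rel F') x y.
Proof.
move=> FF; apply: connect_sub => a b ab; apply: connect1.
exact: edge_rel_sub FF _ _ ab.
Qed.

Lemma connect_inv (r : rel T) (P : pred T) x y :
  (forall a b, r a b -> P a -> P b) -> connect r x y -> P x -> P y.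
Proof.
move=> step /connectP[l + ->]; elim: l x => //= z l IH x /andP[xz zl] Px.
exact: IH zl (step _ _ xz Px).
Qed.

Definition tree_on S F : Prop :=
  [/\ subgraph_edges e F, forall E, E \in F -> E \subset S,
      {in S &, forall x y, connect (edge_rel F) x y}
    & forall x y, [set x; y] \in F -> x != y ->
        ~~ connect (edge_rel (F :\ [set x; y])) x y].

Lemma tree_on1 x : tree_on [set x] set0.
Proof.
split=> [E|E|y z /set1P-> /set1P->|y z]; rewrite ?inE //.
Qed.

Lemma tree_add S F p q : tree_on S F -> p \in S -> q \notin S -> e p q ->
  tree_on (q |: S) ([set p; q] |: F).
Proof.
case=> sub inS con acy pS qS epq.
have pq : p != q by apply: contraNneq qS => <-.
have FF : F \subset [set p; q] |: F by exact: subsetUr.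
have cpq : connect (edge_rel ([set p; q] |: F)) p q.
  by apply: connect1; rewrite /edge_rel pq setU11.
split.
- move=> E /setU1P[->|/sub //]; by exists p, q.
- move=> E /setU1P[->|/inS ES].
    by apply/subsetP => x /set2P[]->; rewrite !inE ?eqxx ?pS ?orbT.
  exact: subset_trans ES (subsetUr _ _).
- have toq x : x \in S -> connect (edge_rel ([set p; q] |: F)) x q.
    by move=> xS; apply: connect_trans cpq; apply: connect_sub_edges FF _; apply: con.
  have sc := sym_connect_sym (edge_rel_sym ([set p; q] |: F)).
  move=> x y /setU1P[->|xS] /setU1P[->|yS]; first exact: connect0.
  + by rewrite sc; apply: toq.
  + exact: toq.
  by apply: connect_trans (toq _ xS) _; rewrite sc; apply: toq.
have qF E : E \in F -> q \notin E.
  by move=> /inS/subsetP ES; apply: contra qS => /ES.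
move=> x y xyF xy; have [xyE|xyN] := eqVneq [set x; y] [set p; q].
  have iso : forall a b, edge_rel (([set p; q] |: F) :\ [set p; q]) a b ->
      (a == q) -> (b == q).
    move=> a b /andP[_]; rewrite !inE => /andP[/negPf-> /= abF] /eqP aq.
    by have := qF _ abF; rewrite aq !inE eqxx.
  rewrite xyE; apply/negP => cxy.
  have xyq : (x == q) || (y == q).
    have : q \in [set x; y] by rewrite xyE !inE eqxx orbT.
    by rewrite !inE !(eq_sym q).
  case/orP: xyq => hq.
    by have /eqP yq := connect_inv iso cxy hq; rewrite (eqP hq) yq eqxx in xy.
  rewrite (sym_connect_sym (edge_rel_sym _)) in cxy.
  by have /eqP xq := connect_inv iso cxy hq; rewrite xq (eqP hq) eqxx in xy.
have {}xyF : [set x; y] \in F by move: xyF; rewrite in_setU1 (negPf xyN).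
have /subsetP xyS := inS _ xyF.
have xS : x \in S by apply: xyS; rewrite set21.
have yS : y \in S by apply: xyS; rewrite set22.
apply: contra (acy x y xyF xy) => cxy.
(* Retracting the pendant vertex [q] to its neighbour [p] turns a walk in the larger tree into a
   walk in [F], so a connection of [x] and [y] avoiding their edge would already exist in [F]. *)
pose P z := connect (edge_rel (F :\ [set x; y])) x (if z == q then p else z).
have yq : y == q = false by apply: contraNF qS => /eqP <-.
have xq : x == q = false by apply: contraNF qS => /eqP <-.
suff : P y by rewrite /P yq.
apply: (connect_inv (P := P)) cxy _; last by rewrite /P xq connect0.
move=> a b /andP[ab]; rewrite !inE => /andP[abxy /orP[/eqP abpq|abF]] Pa.
  have : a \in [set p; q] by rewrite -abpq set21.
  have : b \in [set p; q] by rewrite -abpq set22.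
  by case/set2P=> -> /set2P aE; move: Pa; rewrite /P; case: aE => ->; rewrite ?eqxx ?(negPf pq).
have := qF _ abF; rewrite !inE negb_or ![q == _]eq_sym => /andP[/negPf aq /negPf bq].
move: Pa; rewrite /P aq bq => Pa; apply: connect_trans Pa _; apply: connect1.
by rewrite /edge_rel ab !inE abxy.
Qed.

Fixpoint path_edges p (l : seq T) : {set {set T}} :=
  if l is q :: l' then [set p; q] |: path_edges q l' else set0.

Lemma path_edge_rel F p l : uniq (p :: l) -> path_edges p l \subset F ->
  path (edge_rel F) p l.
Proof.
elim: l p => //= q l IH p /andP[pN ql] /subsetP lF.
rewrite IH ?andbT // /edge_rel; last by apply/subsetP => E El; apply: lF; rewrite inE El orbT.
by rewrite lF ?setU11 // andbT; move: pN; rewrite inE negb_or => /andP[].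
Qed.

Lemma tree_path S F p l : tree_on S F -> p \in S -> path e p l -> uniq l ->
  {in l, forall x, x \notin S} ->
  tree_on (S :|: [set x in l]) (path_edges p l :|: F).
Proof.
elim: l p S F => [|q l IH] p S F tr pS /=.
  by move=> _ _ _; rewrite set0U; have -> : S :|: [set x in [::]] = S by apply/setP=> x; rewrite !inE orbF.
move=> /andP[pq ql] /andP[qN lu] lS.
have tr' := tree_add tr pS (lS q (mem_head _ _)) pq.
have := IH q _ _ tr' (setU11 _ _) ql lu _.
have -> : (q |: S) :|: [set x in l] = S :|: [set x in q :: l].
  by apply/setP => x; rewrite !inE orbCA orbA.
rewrite setUCA setUA; apply=> x xl; rewrite !inE negb_or lS ?inE ?xl ?orbT // andbT.
by apply: contraNneq qN => <-.
Qed.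

Lemma inner_not_leaf F a x v z b : uniq (rcons a x ++ v :: z :: b) ->
  sorted (edge_rel F) (rcons a x ++ v :: z :: b) -> deg (edge_rel F) v != 1.
Proof.
rewrite cat_rcons => un; have {un} xz : x != z.
  move: un; rewrite cat_uniq => /and3P[_ _ /=].
  by rewrite !inE !negb_or => /andP[/and3P[_ -> _]].
move=> /cat_sorted2[_ /= /and3P[xv vz _]].
rewrite /deg neq_ltn; apply/orP; right.
have -> : 2 = #|[set x; z]| by rewrite cards2 xz.
by apply/subset_leq_card/subsetP => y /set2P[]->; rewrite inE // edge_rel_sym.
Qed.

Lemma path_leaf F l v d : uniq l -> sorted (edge_rel F) l -> v \in l ->
  deg (edge_rel F) v == 1 -> (v == head d l) || (v == last d l).
Proof.
move=> un so /splitPr vl; case: vl un so => a b.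
case/lastP: a => [|a x]; first by rewrite eqxx.
case: b => [|z b]; first by rewrite last_cat /= eqxx orbT.
by move=> un so /negPn; rewrite (inner_not_leaf un so).
Qed.

End Grow.

(** * Frames and their symmetries *)

Section Frames.

Variables (T : finType) (e : rel T).
Hypothesis e_sym : symmetric e.

Implicit Types (c d l : seq T) (L : seq (T * seq T)) (s t u v w x y z : T).

Lemma sorted_mid l x l' :
  sorted e (l ++ x :: l') = sorted e (rcons l x) && sorted e (x :: l').
Proof. by case: l => [|y l] //=; rewrite cat_path /= rcons_path andbA. Qed.

Lemma sorted_revE l : sorted e (rev l) = sorted e l.
Proof. by rewrite rev_sorted; apply: eq_sorted => x y; rewrite e_sym. Qed.

Lemma sorted_catl l l' : sorted e (l ++ l') -> sorted e l.
Proof. by case/cat_sorted2. Qed.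

Lemma sorted_catr l l' : sorted e (l ++ l') -> sorted e l'.
Proof. by case/cat_sorted2. Qed.

(* A frame is a tree given by its core c1 ++ w :: c2 and its legs.  A leg is a
   pair of an anchor on the core and the list of the leg's own vertices, ordered
   from the leaf towards the anchor.  For an empty leg, [leaf] is the anchor. *)
Definition core_ends c1 w c2 : seq T :=
  [:: head w c1; head w c1; w; last w c2; last w c2].

Definition vertices c1 w c2 L : seq T := (c1 ++ w :: c2) ++ flatten (unzip2 L).

(** The anchors need only be a permutation of [core_ends], so legs can be relisted freely; when the
    third anchor is an end of the core, all legs there are interchangeable. The count [m] is what
    the exchanges preserve. *)
Definition frame (m : nat) c1 w c2 L : bool :=
  [&& sorted e (c1 ++ w :: c2), perm_eq (unzip1 L) (core_ends c1 w c2),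
      all (fun p => sorted e (rcons p.2 p.1)) L,
      uniq (vertices c1 w c2 L) & size (vertices c1 w c2 L) == m].

Definition legs5 c1 w c2 l1 l2 l3 l4 l5 : seq (T * seq T) :=
  [:: (head w c1, l1); (head w c1, l2); (w, l3); (last w c2, l4); (last w c2, l5)].

Definition leaf (p : T * seq T) : T := head p.1 p.2.

Lemma frameP m c1 w c2 l1 l2 l3 l4 l5 :
  frame m c1 w c2 (legs5 c1 w c2 l1 l2 l3 l4 l5) ->
  [/\ sorted e (c1 ++ w :: c2),
      sorted e (rcons l1 (head w c1)) && sorted e (rcons l2 (head w c1)),
      sorted e (rcons l3 w),
      sorted e (rcons l4 (last w c2)) && sorted e (rcons l5 (last w c2))
    & uniq (vertices c1 w c2 (legs5 c1 w c2 l1 l2 l3 l4 l5))].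
Proof. by case/and5P=> ? _ /= /and5P[-> -> -> -> /andP[-> _]]. Qed.

Lemma frameI m c1 w c2 L c1' w' c2' L' :
  frame m c1 w c2 L ->
  sorted e (c1' ++ w' :: c2') -> perm_eq (unzip1 L') (core_ends c1' w' c2') ->
  all (fun p => sorted e (rcons p.2 p.1)) L' ->
  perm_eq (vertices c1' w' c2' L') (vertices c1 w c2 L) ->
  frame m c1' w' c2' L'.
Proof.
case/and5P=> _ _ _ u /eqP <- *; apply/and5P; split=> //.
  by rewrite (perm_uniq (s2 := vertices c1 w c2 L)).
by rewrite (perm_size (s2 := vertices c1 w c2 L)).
Qed.

Lemma frame_perm m c1 w c2 L L' :
  perm_eq L L' -> frame m c1 w c2 L -> frame m c1 w c2 L'.
Proof.
move=> pL fr; have [s p a _ _] := and5P fr; apply: (frameI fr) => //.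
- by rewrite -(permPl (perm_map _ pL)).
- by rewrite -(perm_all _ pL).
by rewrite perm_cat2l perm_sym perm_flatten // perm_map.
Qed.

Lemma last_rev w c : last w (rev c) = head w c.
Proof. by case: c => [|x c] //=; rewrite rev_cons last_rcons. Qed.

Lemma head_rev w c : head w (rev c) = last w c.
Proof. by elim/last_ind: c => [|c x _] //; rewrite rev_rcons last_rcons. Qed.

Ltac perm_vertices :=
  rewrite /vertices /legs5 /= ?cats0; apply/permP => ?;
  clear; do 4?[rewrite ?(rev_cat, rev_cons) -?cats1 /= ?(count_cat, count_rev) /=]; lia.

Lemma frame_mirror m c1 w c2 L :
  frame m c1 w c2 L -> frame m (rev c2) w (rev c1) L.
Proof.
move=> fr; have [s p a _ _] := and5P fr; apply: (frameI fr) => //.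
- by rewrite -cat_rcons -rev_cons -rev_cat sorted_revE.
- rewrite (permPl p) /core_ends head_rev last_rev.
  by apply/permP => b; clear; rewrite /=; lia.
by perm_vertices.
Qed.

Lemma legs5_mirror c1 w c2 l1 l2 l3 l4 l5 :
  perm_eq (legs5 c1 w c2 l1 l2 l3 l4 l5) (legs5 (rev c2) w (rev c1) l4 l5 l3 l1 l2).
Proof. by rewrite /legs5 head_rev last_rev; apply/permP => b /=; lia. Qed.

Lemma frame_mirror5 m c1 w c2 l1 l2 l3 l4 l5 :
  frame m c1 w c2 (legs5 c1 w c2 l1 l2 l3 l4 l5) ->
  frame m (rev c2) w (rev c1) (legs5 (rev c2) w (rev c1) l4 l5 l3 l1 l2).
Proof. by move/frame_mirror; apply/frame_perm/legs5_mirror. Qed.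

Lemma frame_swap5 m c1 w c2 l1 l2 l3 l4 l5 :
  frame m c1 w c2 (legs5 c1 w c2 l1 l2 l3 l4 l5) ->
  frame m c1 w c2 (legs5 c1 w c2 l2 l1 l3 l4 l5).
Proof. by apply/frame_perm/permP => b; clear; rewrite /=; lia. Qed.

Lemma frame_swap5r m c1 w c2 l1 l2 l3 l4 l5 :
  frame m c1 w c2 (legs5 c1 w c2 l1 l2 l3 l4 l5) ->
  frame m c1 w c2 (legs5 c1 w c2 l1 l2 l3 l5 l4).
Proof. by apply/frame_perm/permP => b; clear; rewrite /=; lia. Qed.

(** * Exchanges that keep the vertex set *)

Lemma sorted_rcons_link l x y l' :
  sorted e (rcons l x) -> e x y -> sorted e (y :: l') -> sorted e (rcons l x ++ y :: l').
Proof. by rewrite cat_rcons sorted_mid /= => -> -> ->. Qed.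

Lemma sorted_rev_link x l y l' a :
  sorted e (rcons (x :: l) a) -> e x y -> sorted e (y :: l') ->
  sorted e (rev (x :: l) ++ y :: l').
Proof.
move=> xl xy yl; rewrite rev_cons; apply: sorted_rcons_link => //.
by rewrite -rev_cons sorted_revE; rewrite -cats1 in xl; apply: sorted_catl xl.
Qed.

(* Linking two leaves by an edge puts one leg onto the other and leaves the
   first anchor with an empty leg. *)
Lemma frame_join m c1 w c2 a u l b v l' L :
  frame m c1 w c2 ((a, u :: l) :: (b, v :: l') :: L) -> e u v ->
  frame m c1 w c2 ((a, [::]) :: (b, rev (u :: l) ++ v :: l') :: L).
Proof.
move=> fr uv; have [s p /and3P[pl pl' aL] _ _] := and5P fr; apply: (frameI fr) => //.
  apply/and3P; split=> //=; rewrite rcons_cat.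
  by apply: sorted_rev_link pl uv pl'.
by perm_vertices.
Qed.

(** The beginning of a leg, from its leaf to [y], moves in front of the leaf [v] of another leg. The
    vertex after [y] becomes a leaf; if [l'] is empty, so is the leg left behind. *)
Lemma frame_shift m c1 w c2 a l y l' b v k L :
  frame m c1 w c2 ((a, rcons l y ++ l') :: (b, v :: k) :: L) -> e y v ->
  frame m c1 w c2 ((a, l') :: (b, rcons l y ++ v :: k) :: L).
Proof.
move=> fr yv; have [s p /and3P[/= pl pl' aL] _ _] := and5P fr; apply: (frameI fr) => //.
  rewrite rcons_cat in pl.
  apply/and3P; split=> //=; first exact: sorted_catr pl.
  by rewrite rcons_cat; apply: sorted_rcons_link yv pl'; apply: sorted_catl pl.
by perm_vertices.
Qed.

(** A leaf adjacent to two consecutive core vertices goes between them: the core gains a vertex from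
    a leg. This is what [core_pair] rules out. *)
Lemma frame_insert m d y b w c2 a u l L :
  frame m (d ++ y :: b) w c2 ((a, u :: l) :: L) -> e y u -> e (head w b) u ->
  frame m (d ++ y :: u :: b) w c2 ((a, l) :: L).
Proof.
move=> fr yu zu; have [s p /andP[/= pl aL] _ _] := and5P fr; apply: (frameI fr) => //.
- move: s; rewrite -!catA !cat_cons !(sorted_mid d) => /andP[-> /=].
  by case: b zu {fr p} => [|z b] /= zu /andP[_ ->]; rewrite yu e_sym zu.
- by case: d p {fr s}.
- by rewrite /= (path_sorted pl).
by perm_vertices.
Qed.

Lemma sorted_leg_split a x b s :
  sorted e (rcons (a ++ x :: b) s) -> sorted e (rcons a x) /\ sorted e (x :: rcons b s).
Proof. by rewrite rcons_cat sorted_mid => /andP. Qed.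

Lemma sorted_core l c1 w c2 :
  sorted e (rcons l (head w c1)) -> sorted e (c1 ++ w :: c2) ->
  sorted e (l ++ c1 ++ w :: c2).
Proof. by case: c1 => [|s c1] sl sc; rewrite sorted_mid sl. Qed.

(* The branch l1 = a ++ x :: b is cut open at x, where the whole of l2 is
   hooked on: the segment x :: b joins the core. *)
Lemma frame_sibling m c1 w c2 a x b u l2 l3 l4 l5 :
  frame m c1 w c2 (legs5 c1 w c2 (a ++ x :: b) (u :: l2) l3 l4 l5) -> e x u ->
  frame m (x :: b ++ c1) w c2 (legs5 (x :: b ++ c1) w c2 a (rev (u :: l2)) l3 l4 l5).
Proof.
move=> fr xu; have [s /andP[p1 p2] p3 /andP[p4 p5] _] := frameP fr.
have [pa pb] := sorted_leg_split p1; apply: (frameI fr).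
- by rewrite -cat_cons -catA; apply: sorted_core.
- exact: perm_refl.
- rewrite /= pa p3 p4 p5 !andbT -cats1.
  by apply: sorted_rev_link p2 _ _; rewrite // e_sym.
by perm_vertices.
Qed.

Lemma frame_third_on_first m c1 w c2 u l1 l2 a x b l4 l5 r s :
  frame m c1 w c2 (legs5 c1 w c2 (u :: l1) l2 (a ++ x :: b) l4 l5) -> e x u ->
  c1 ++ w :: c2 = s :: r ->
  frame m (x :: u :: l1) s r (legs5 (x :: u :: l1) s r a (rev b) l2 l4 l5).
Proof.
move=> fr xu sr; have [sc /andP[p1 p2] p3 /andP[p4 p5] _] := frameP fr.
have [pa pb] := sorted_leg_split p3.
have hs : head w c1 = s by case: (c1) sr => [|? ?] [].
have lr : last w c2 = last s r.
  by rewrite -[RHS]/(last s (s :: r)) -sr last_cat.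
rewrite ?hs ?lr in p1 p2 p4 p5; apply: (frameI fr).
- by rewrite /= xu /= -cat_rcons; move: p1; rewrite /= cat_path => ->; rewrite last_rcons; move: sc; rewrite sr.
- exact: perm_refl.
- rewrite /= pa p2 p4 p5 !andbT -rev_cons sorted_revE.
  by rewrite -rcons_cons -cats1 in pb; apply: sorted_catl pb.
rewrite /vertices sr; by perm_vertices.
Qed.

(** The segment [x :: b] prolongs the core beyond [s]. The third leg leaves [w] and hangs by its
    leaf on [x], while the second stays at [s] as third leg. *)
Lemma frame_first_on_third m c1 w c2 a x b l2 u l3 l4 l5 r s :
  frame m c1 w c2 (legs5 c1 w c2 (a ++ x :: b) l2 (u :: l3) l4 l5) -> e x u ->
  c1 ++ w :: c2 = s :: r ->
  frame m (x :: b) s r (legs5 (x :: b) s r a (rev (u :: l3)) l2 l4 l5).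
Proof.
move=> fr xu sr; have [sc /andP[p1 p2] p3 /andP[p4 p5] _] := frameP fr.
have [pa pb] := sorted_leg_split p1.
have hs : head w c1 = s by case: (c1) sr => [|? ?] [].
have lr : last w c2 = last s r.
  by rewrite -[RHS]/(last s (s :: r)) -sr last_cat.
rewrite ?hs ?lr in p1 p2 p4 p5 pb; apply: (frameI fr).
- by rewrite sorted_mid pb -sr.
- exact: perm_refl.
- rewrite /= pa p2 p4 p5 !andbT -cats1.
  by apply: sorted_rev_link p3 _ _; rewrite // e_sym.
rewrite /vertices sr; by perm_vertices.
Qed.

(** The last vertex [v] of the third leg is adjacent to [w] anyway, so it fits between [w] and [z]
    and becomes the new third anchor. *)
Lemma frame_extend_third m c1 w z c2 l1 l2 l v l4 l5 :
  frame m c1 w (z :: c2) (legs5 c1 w (z :: c2) l1 l2 (rcons l v) l4 l5) -> e v z ->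
  frame m (rcons c1 w) v (z :: c2) (legs5 (rcons c1 w) v (z :: c2) l1 l2 l l4 l5).
Proof.
move=> fr vz; have [sc p12 p3 p45 _] := frameP fr.
have hc : head v (rcons c1 w) = head w c1 by case: (c1).
have [pl vw] : sorted e (rcons l v) /\ e v w.
  by move: p3; rewrite -cats1 cat_rcons sorted_mid /= andbT => /andP.
apply: (frameI fr).
- move: sc; rewrite cat_rcons !(sorted_mid c1) => /andP[-> /= /andP[_ ->]].
  by rewrite e_sym vw vz.
- exact: perm_refl.
- by rewrite /= hc pl !andbT; move: p12 p45 => /andP[-> ->] /andP[/= -> ->].
by perm_vertices.
Qed.

(* Cutting w off the core is compensated by the chord from its predecessor to
   its successor. *)
Lemma frame_bypass m d y w z c2 u l1 l2 l3 l4 l5 :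
  frame m (rcons d y) w (z :: c2) (legs5 (rcons d y) w (z :: c2) (u :: l1) l2 l3 l4 l5) ->
  e y z -> e w u ->
  frame m d y (z :: c2) (legs5 d y (z :: c2) (rcons l3 w ++ u :: l1) l2 [::] l4 l5).
Proof.
move=> fr yz wu; have [sc /andP[p1 p2] p3 p45 _] := frameP fr.
have hc : head w (rcons d y) = head y d by case: (d).
rewrite hc in p1 p2; apply: (frameI fr).
- move: sc; rewrite cat_rcons !(sorted_mid d) => /andP[-> /=].
  by rewrite yz => /and3P[_ _ ->].
- exact: perm_refl.
- rewrite /= p2 !andbT; move: p45 => /andP[/= -> ->]; rewrite !andbT.
  by rewrite rcons_cat; apply: sorted_rcons_link.
by perm_vertices.
Qed.

(* Rotation: the chord from a core vertex to a leaf replaces a core edge, so the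
   leg enters the core and the segment a of the core becomes a leg. *)
Lemma frame_rot_first m s a b w c2 u l1 l2 l3 l4 l5 :
  frame m (s :: a ++ b) w c2 (legs5 (s :: a ++ b) w c2 (u :: l1) l2 l3 l4 l5) ->
  e (head w b) u ->
  frame m (s :: rev (u :: l1) ++ b) w c2
    (legs5 (s :: rev (u :: l1) ++ b) w c2 (rev a) l2 l3 l4 l5).
Proof.
move=> fr zu; have [sc /andP[p1 p2] p3 p45 _] := frameP fr.
rewrite /= in p1 p2; have sa : sorted e (s :: a).
  by move: sc; rewrite -cat_cons -catA => /sorted_catl.
have sb : sorted e (b ++ w :: c2) by move: sc; rewrite -cat_cons -catA => /sorted_catr.
apply: (frameI fr).
- have su : sorted e (rcons (s :: rev l1) u).
    by rewrite rcons_cons -rev_cons -rev_rcons sorted_revE.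
  rewrite -cat_cons -catA rev_cons -rcons_cons.
  rewrite e_sym in zu; case: b zu sb {sc fr} => [|z b] zu sb.
    exact: sorted_rcons_link su zu sb.
  exact: sorted_rcons_link su zu sb.
- exact: perm_refl.
- by case/andP: p45 => p4 p5; rewrite /= p2 p3 p4 p5 -rev_cons sorted_revE sa.
by perm_vertices.
Qed.

Lemma frame_rot_third m d y b w c2 l1 l2 u l3 l4 l5 :
  frame m (rcons d y ++ b) w c2 (legs5 (rcons d y ++ b) w c2 l1 l2 (u :: l3) l4 l5) ->
  e y u ->
  frame m (rcons d y ++ u :: l3) w c2
    (legs5 (rcons d y ++ u :: l3) w c2 l1 l2 b l4 l5).
Proof.
move=> fr yu; have [sc p12 p3 p45 _] := frameP fr.
have hd r : head w (rcons d y ++ r) = head y d by case: (d).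
rewrite -catA in sc; apply: (frameI fr).
- rewrite -catA; apply: sorted_rcons_link yu _; first exact: sorted_catl sc.
  by rewrite -cat_cons sorted_mid p3; apply: sorted_catr (sorted_catr sc).
- exact: perm_refl.
- rewrite /= !hd in p12 *; move: p12 p45 => /andP[-> ->] /andP[/= -> ->].
  by move: (sorted_catr sc); rewrite sorted_mid => /andP[-> _].
by perm_vertices.
Qed.

(** The detour through the fourth leg reaches the right part of the core at its far end [t], so this
    part is traversed backwards: [t] becomes the middle vertex, and [w] the right end carrying [l3]
    and [b]. *)
Lemma frame_rot_fourth m d y b w c2 t l1 l2 l3 u l4 l5 :
  frame m (rcons d y ++ b) w (rcons c2 t)
    (legs5 (rcons d y ++ b) w (rcons c2 t) l1 l2 l3 (u :: l4) l5) ->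
  e y u ->
  frame m (rcons d y ++ u :: l4) t (rcons (rev c2) w)
    (legs5 (rcons d y ++ u :: l4) t (rcons (rev c2) w) l1 l2 l5 l3 b).
Proof.
move=> fr yu; have [sc p12 p3 p45 _] := frameP fr.
have hd x r : head x (rcons d y ++ r) = head y d by case: (d).
rewrite last_rcons in p45; case/andP: p45 => p4 p5.
rewrite -catA in sc; apply: (frameI fr).
- rewrite -catA; apply: sorted_rcons_link yu _; first exact: sorted_catl sc.
  rewrite -cat_cons sorted_mid p4 /= -/(sorted e (t :: rcons (rev c2) w)).
  have := sorted_catr (sorted_catr sc).
  by rewrite -sorted_revE rev_cons rev_rcons.
- exact: perm_refl.
- rewrite /= last_rcons !hd in p12 *; move: p12 => /andP[-> ->]; rewrite p5 p3 /=.
  by move: (sorted_catr sc); rewrite sorted_mid => /andP[-> _].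
by perm_vertices.
Qed.

(** The chord from [y] to the successor of [x] frees [x], which then joins the leaves [u] and [v],
    merging two legs into one. *)
Lemma frame_link m d y x b w c2 a u l a' v l' L :
  frame m (rcons d y ++ x :: b) w c2 ((a, u :: l) :: (a', v :: l') :: L) ->
  e y (head w b) -> e x u -> e x v ->
  frame m (rcons d y ++ b) w c2 ((a, [::]) :: (a', rev (u :: l) ++ x :: v :: l') :: L).
Proof.
move=> fr yz xu xv; have [sc p /and3P[/= pl pl' aL] _ _] := and5P fr.
rewrite -catA in sc; apply: (frameI fr).
- have sd := sorted_catl sc.
  have sb : sorted e (b ++ w :: c2) by case/path_sorted: (sorted_catr sc).
  rewrite -catA; case: (b) yz sb => [|z b'] yz sb; exact: sorted_rcons_link sd yz sb.
- by case: d p {fr sc}.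
- apply/and3P; split=> //; rewrite /= rcons_cat; apply: sorted_rev_link pl _ _.
    by rewrite e_sym.
  by rewrite /= xv.
by perm_vertices.
Qed.

(** Three legs meet at the end [w]. Hanging one of them by its leaf on [x] makes the third anchor
    inner and leaves the core as it is. *)
Lemma frame_third_inside m s a x b w u l1 l2 l3 l4 l5 :
  frame m (s :: a ++ x :: b) w [::] (legs5 (s :: a ++ x :: b) w [::] l1 l2 (u :: l3) l4 l5) ->
  e x u ->
  frame m (s :: a) x (rcons b w) (legs5 (s :: a) x (rcons b w) l1 l2 (rev (u :: l3)) l4 l5).
Proof.
move=> fr xu; have [sc p12 p3 p45 _] := frameP fr; apply: (frameI fr).
- by move: sc; rewrite -cat_cons -catA cat_cons cats1.
- exact: perm_refl.
- rewrite /= last_rcons in p12 p45 *; move: p12 p45 => /andP[-> ->] /andP[-> ->].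
  by rewrite !andbT -cats1; apply: sorted_rev_link p3 _ _; rewrite // e_sym.
by perm_vertices.
Qed.

(** The third leg takes the place of the first at [s], and the first moves to [x], both hanging by
    their old leaves; again the third anchor becomes inner. *)
Lemma frame_exchange_inside m s a x b w v u l1 l2 l3 l4 l5 :
  frame m (s :: a ++ x :: b) w [::]
    (legs5 (s :: a ++ x :: b) w [::] (v :: l1) l2 (u :: l3) l4 l5) ->
  e s u -> e x v ->
  frame m (s :: a) x (rcons b w)
    (legs5 (s :: a) x (rcons b w) l2 (rev (u :: l3)) (rev (v :: l1)) l4 l5).
Proof.
move=> fr su xv; have [sc /andP[p1 p2] p3 /andP[p4 p5] _] := frameP fr; apply: (frameI fr).
- by move: sc; rewrite -cat_cons -catA cat_cons cats1.
- exact: perm_refl.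
- rewrite /= last_rcons in p2 p4 p5 *; rewrite p2 p4 p5 -!cats1 !andbT.
  by apply/and3P; split=> //; [apply: sorted_rev_link p3 _ _ | apply: sorted_rev_link p1 _ _];
    rewrite // e_sym.
by perm_vertices.
Qed.

(** * Growing a frame that has an empty leg *)

Lemma perm_legs A L : perm_eq (unzip1 L) A ->
  exists2 ls, size ls = size A & perm_eq L (zip A ls).
Proof.
elim: A L => [|a A IH] L.
  by case: L => [|p L]; [exists [::] | move/perm_size].
move=> pL; have : a \in unzip1 L by rewrite (perm_mem pL) mem_head.
case/mapP=> -[b l] /perm_to_rem pL' /= ab; rewrite -ab in pL'.
have /IH[ls sz pls] : perm_eq (unzip1 (rem (a, l) L)) A.
  by rewrite -(perm_cons a) -(permPr pL) perm_sym (perm_map fst pL').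
exists (l :: ls); first by rewrite /= sz.
by rewrite (permPl pL') /= perm_cons.
Qed.

Lemma frame_legs5 m c1 w c2 L : frame m c1 w c2 L ->
  exists l1 l2 l3 l4 l5, perm_eq L (legs5 c1 w c2 l1 l2 l3 l4 l5).
Proof.
case/and5P=> _ /perm_legs[[|l1 [|l2 [|l3 [|l4 [|l5 []]]]]] // _ pL] _ _ _.
by exists l1, l2, l3, l4, l5.
Qed.

(** Since no first leg branches off, the left part of the core can prolong the second leg and [w]
    becomes the left end; the empty leg then counts as the third. The core shrinks, but only the
    number of vertices matters here. *)
Lemma frame_short m c1 w c2 l2 l3 l4 l5 :
  frame m c1 w c2 (legs5 c1 w c2 [::] l2 l3 l4 l5) ->
  exists d1 v k1 k2, frame m d1 v c2 (legs5 d1 v c2 k1 k2 [::] l4 l5).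
Proof.
move=> fr; case: c1 => [|s c1] in fr *.
  exists [::], w, l2, l3; apply: frame_perm fr; apply/permP => b; clear; rewrite /=; lia.
exists [::], w, l3, (l2 ++ s :: c1).
have [sc /andP[_ p2] p3 p45 _] := frameP fr; apply: (frameI fr).
- exact: sorted_catr sc.
- exact: perm_refl.
- rewrite /= p3 /=; move: p45 => /andP[-> ->]; rewrite !andbT rcons_cat sorted_mid p2.
  by move: sc; rewrite sorted_mid => /andP[].
by perm_vertices.
Qed.

Lemma frame_growI m c1 w c2 L c1' w' c2' L' q :
  frame m c1 w c2 L -> q \notin vertices c1 w c2 L ->
  sorted e (c1' ++ w' :: c2') -> perm_eq (unzip1 L') (core_ends c1' w' c2') ->
  all (fun p => sorted e (rcons p.2 p.1)) L' ->
  perm_eq (vertices c1' w' c2' L') (q :: vertices c1 w c2 L) ->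
  frame m.+1 c1' w' c2' L'.
Proof.
case/and5P=> _ _ _ u /eqP <- qN *; apply/and5P; split=> //.
  by rewrite (perm_uniq (s2 := q :: vertices c1 w c2 L)) //= qN.
by rewrite (perm_size (s2 := q :: vertices c1 w c2 L)).
Qed.

Lemma frame_grow_leaf m c1 w c2 a u l L q :
  frame m c1 w c2 ((a, u :: l) :: L) ->
  q \notin vertices c1 w c2 ((a, u :: l) :: L) -> e q u ->
  frame m.+1 c1 w c2 ((a, q :: u :: l) :: L).
Proof.
move=> fr qN qu; have [s p /andP[pl aL] _ _] := and5P fr.
apply: (frame_growI fr qN) => //; last by perm_vertices.
by apply/andP; split=> //=; rewrite qu.
Qed.

(** An empty third leg may be anchored anywhere, so the core is split anew at [p]. *)
Lemma frame_grow_core m c1 w c2 l1 l2 l4 l5 d1 p d2 q :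
  frame m c1 w c2 (legs5 c1 w c2 l1 l2 [::] l4 l5) ->
  q \notin vertices c1 w c2 (legs5 c1 w c2 l1 l2 [::] l4 l5) ->
  c1 ++ w :: c2 = d1 ++ p :: d2 -> e q p ->
  frame m.+1 d1 p d2 (legs5 d1 p d2 l1 l2 [:: q] l4 l5).
Proof.
move=> fr qN cd qp; have [sc p12 _ p45 _] := frameP fr.
have hd : head p d1 = head w c1.
  by case: (d1) (c1) cd => [|? ?] [|? ?] [].
have lt : last p d2 = last w c2.
  by have := congr1 (last p) cd; rewrite !last_cat.
apply: (frame_growI fr qN).
- by rewrite -cd.
- exact: perm_refl.
- by rewrite /= hd lt qp /=; move: p12 p45 => /andP[-> ->] /andP[-> ->].
rewrite /vertices -cd; by perm_vertices.
Qed.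

(** The core is prolonged along the first leg up to [p], where [q] becomes a leg; the second leg
    fills the vacant third place. *)
Lemma frame_grow_first m c1 w c2 a p b l2 l4 l5 r s q :
  frame m c1 w c2 (legs5 c1 w c2 (a ++ p :: b) l2 [::] l4 l5) ->
  q \notin vertices c1 w c2 (legs5 c1 w c2 (a ++ p :: b) l2 [::] l4 l5) ->
  c1 ++ w :: c2 = s :: r -> e q p ->
  frame m.+1 (p :: b) s r (legs5 (p :: b) s r a [:: q] l2 l4 l5).
Proof.
move=> fr qN sr qp; have [sc /andP[p1 p2] _ p45 _] := frameP fr.
have [pa pb] := sorted_leg_split p1.
have hs : head w c1 = s by case: (c1) sr => [|? ?] [].
have lr : last w c2 = last s r.
  by rewrite -[RHS]/(last s (s :: r)) -sr last_cat.
rewrite ?hs ?lr in p2 p45 pb; apply: (frame_growI fr qN).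
- by rewrite sorted_mid pb -sr.
- exact: perm_refl.
- by rewrite /= pa qp p2 /=; move: p45 => /andP[-> ->].
rewrite /vertices sr; by perm_vertices.
Qed.

Lemma frame_short_any m c1 w c2 L :
  frame m c1 w c2 L -> has (fun p => p.2 == [::]) L ->
  exists d1 v d2 k1 k2 k4 k5, frame m d1 v d2 (legs5 d1 v d2 k1 k2 [::] k4 k5).
Proof.
move=> fr; have [l1 [l2 [l3 [l4 [l5 pL]]]]] := frame_legs5 fr.
rewrite (perm_has _ pL) /= orbF; move: fr => /(frame_perm pL) fr.
have short d1 v d2 k2 k3 k4 k5 : frame m d1 v d2 (legs5 d1 v d2 [::] k2 k3 k4 k5) ->
    exists d1 v d2 k1 k2 k4 k5, frame m d1 v d2 (legs5 d1 v d2 k1 k2 [::] k4 k5).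
  by move=> /frame_short[? [? [? [? ?]]]]; do 7!eexists; eassumption.
case/or4P=> [/eqP l0|/eqP l0|/eqP l0|/orP[]/eqP l0]; rewrite {}l0 in fr.
- exact: short fr.
- exact: short (frame_swap5 fr).
- by do 7!eexists; exact: fr.
- exact: short (frame_mirror5 fr).
exact: short (frame_swap5 (frame_mirror5 fr)).
Qed.

Lemma frame_grow m c1 w c2 l1 l2 l4 l5 p q :
  frame m c1 w c2 (legs5 c1 w c2 l1 l2 [::] l4 l5) ->
  p \in vertices c1 w c2 (legs5 c1 w c2 l1 l2 [::] l4 l5) ->
  q \notin vertices c1 w c2 (legs5 c1 w c2 l1 l2 [::] l4 l5) -> e q p ->
  exists d1 v d2 K, frame m.+1 d1 v d2 K.
Proof.
have first d1 v d2 k1 k2 k4 k5 :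
    frame m d1 v d2 (legs5 d1 v d2 k1 k2 [::] k4 k5) -> p \in k1 ->
    q \notin vertices d1 v d2 (legs5 d1 v d2 k1 k2 [::] k4 k5) -> e q p ->
    exists d1 v d2 K, frame m.+1 d1 v d2 K.
  move=> fr /splitPr pk; case: pk fr => a b fr qN qp.
  have [s [r sr]] : exists s r, d1 ++ v :: d2 = s :: r.
    by case: (d1) => [|x d]; do 2!eexists.
  by do 4!eexists; apply: frame_grow_first fr qN sr qp.
move=> fr; rewrite mem_cat => /orP[pc qN qp|].
  have [d1 [d2 cd]] : exists d1 d2, c1 ++ w :: c2 = d1 ++ p :: d2.
    by case/splitPr: pc => d1 d2; exists d1, d2.
  by do 4!eexists; apply: frame_grow_core fr qN cd qp.
move=> pl qN qp; set V := vertices _ _ _ _ in qN.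
have swap : q \notin vertices c1 w c2 (legs5 c1 w c2 l2 l1 [::] l4 l5).
  by rewrite (perm_mem (_ : perm_eq _ V)); last by rewrite /V; perm_vertices.
have mir : q \notin vertices (rev c2) w (rev c1) (legs5 (rev c2) w (rev c1) l4 l5 [::] l1 l2).
  by rewrite (perm_mem (_ : perm_eq _ V)); last by rewrite /V; perm_vertices.
have mirs : q \notin vertices (rev c2) w (rev c1) (legs5 (rev c2) w (rev c1) l5 l4 [::] l1 l2).
  by rewrite (perm_mem (_ : perm_eq _ V)); last by rewrite /V; perm_vertices.
move: pl; rewrite /= cats0 !mem_cat => /or4P[] p1.
- exact: first fr p1 qN qp.
- exact: first (frame_swap5 fr) p1 swap qp.
- exact: first (frame_mirror5 fr) p1 mir qp.
exact: first (frame_swap5 (frame_mirror5 fr)) p1 mirs qp.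
Qed.

Lemma frame1 v : frame 1 [::] v [::] (legs5 [::] v [::] [::] [::] [::] [::] [::]).
Proof. by apply/and5P; split; rewrite // /core_ends. Qed.

Lemma perm_two (X : eqType) (p q : X) (A : seq X) :
  p \in A -> q \in A -> p != q -> exists B, perm_eq A (p :: q :: B).
Proof.
move=> pA qA pq; exists (rem q (rem p A)); apply: (perm_trans (perm_to_rem pA)).
rewrite perm_cons; apply: perm_to_rem.
have := perm_to_rem pA => /perm_mem/(_ q); rewrite qA inE eq_sym (negPf pq) /=.
by move=> <-.
Qed.

Definition leaf_seq L : seq T := [seq leaf p | p <- L].

(** * Consequences of maximality: leaves and legs *)

Section Maximal.

Variables (m K : nat).
Hypothesis all_legs :
  forall c1 w c2 L, frame m c1 w c2 L -> all (fun p => p.2 != [::]) L.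
Hypothesis e_irr : irreflexive e.
Hypothesis e_star : star_free e 5.
Hypothesis core_max :
  forall c1 w c2 L, frame m c1 w c2 L -> size c1 + size c2 <= K.

Definition optimal c1 w c2 L : bool :=
  frame m c1 w c2 L && (size c1 + size c2 == K).

Lemma frame_two c1 w c2 L p q : frame m c1 w c2 L ->
  p \in L -> q \in L -> p != q ->
  exists l l' L', [/\ p.2 = leaf p :: l, q.2 = leaf q :: l',
                      perm_eq L (p :: q :: L') & frame m c1 w c2 (p :: q :: L')].
Proof.
move=> fr pL qL pq; have [L' pLL'] := perm_two pL qL pq.
have fr' := frame_perm pLL' fr; have /and3P[/= p0 q0 _] := all_legs fr'.
case: p p0 {pL pq} pLL' fr' => a [|u l] //= _; case: q q0 {qL} => b [|v l'] //= _ pLL' fr'.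
by exists l, l', L'.
Qed.

Lemma leaves_indep c1 w c2 L p q : frame m c1 w c2 L ->
  p \in L -> q \in L -> p != q -> ~~ e (leaf p) (leaf q).
Proof.
move=> fr pL qL pq; have [l [l' [L' [pl ql _ fr']]]] := frame_two fr pL qL pq.
apply/negP=> epq; move: pl ql fr' epq; rewrite /leaf.
case: p {pL pq} => a p; case: q {qL} => b q /= -> -> fr' /= epq.
by have /all_legs := frame_join fr' epq.
Qed.

(** Otherwise [frame_shift] would move the whole leg onto that leaf and leave an empty one. *)
Lemma leg_end c1 w c2 L a l y q : frame m c1 w c2 L ->
  (a, rcons l y) \in L -> q \in L -> (a, rcons l y) != q -> ~~ e y (leaf q).
Proof.
move=> fr pL qL pq; have [_ [l' [L' [_ ql _ fr']]]] := frame_two fr pL qL pq.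
apply/negP=> yq; case: q ql yq fr' {qL pq} => b q /= -> /= yq.
by rewrite -[rcons l y]cats0 => fr'; have /all_legs := frame_shift fr' yq.
Qed.

(** Moving the leg up to [y] onto the leaf of [q] makes [z] a leaf of an equally large frame. The
    receiving leg now ends in the old leaf of the cut leg, so [r] may be the cut leg itself. *)
Lemma leg_next c1 w c2 L a l y z l' q r : frame m c1 w c2 L ->
  (a, l ++ y :: z :: l') \in L -> q \in L -> (a, l ++ y :: z :: l') != q ->
  e y (leaf q) -> r \in L -> r != q -> ~~ e z (leaf r).
Proof.
move=> fr pL qL pq yq rL rq; have [_ [k [L' [_ ql LL' fr']]]] := frame_two fr pL qL pq.
move: rL; rewrite (perm_mem LL') !inE (negPf rq) /=.
move: ql fr' yq {LL' rq qL pq}; rewrite /leaf; case: q => b q /= -> fr' /= yq rL.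
rewrite -cat_rcons in fr'; have {}fr' := frame_shift fr' yq.
have nz p : p \in (b, rcons l y ++ head b q :: k) :: L' -> ~~ e z (leaf p).
  move=> pL'; apply: (leaves_indep fr' (p := (a, z :: l'))) => //.
  - by rewrite mem_head.
  - by rewrite inE pL' orbT.
  have [_ _ _ u _] := and5P fr'; apply: contraTneq u => pz.
  set R := _ :: L' in pL' *.
  rewrite cat_uniq -[flatten _]/((z :: l') ++ flatten (unzip2 R)) (cat_uniq (z :: l')).
  apply/negP => /and3P[_ _ /and3P[_ /hasPn zN _]].
  suff /zN : z \in flatten (unzip2 R) by rewrite /= inE eqxx.
  apply/flattenP; exists (z :: l'); rewrite ?mem_head //.
  by apply/mapP; exists (a, z :: l') => //; rewrite pz.
case/predU1P: rL => [->|rL']; last by apply: nz; rewrite inE rL' orbT.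
have := nz _ (mem_head _ _); rewrite /leaf /=.
by case: (l) => [|? ?].
Qed.

Lemma frame_leaves_uniq c1 w c2 L : frame m c1 w c2 L ->
  uniq (c1 ++ w :: c2 ++ leaf_seq L).
Proof.
move=> fr; have [_ _ _ u _] := and5P fr; have := all_legs fr.
have -> : c1 ++ w :: c2 ++ leaf_seq L = (c1 ++ w :: c2) ++ leaf_seq L by rewrite -catA.
move: u; rewrite /vertices; elim: L {fr} (c1 ++ w :: c2) => //= -[a l] L IH c.
case: l => [|u l] //= cu /= al.
rewrite (perm_uniq (s2 := (rcons c u) ++ leaf_seq L)); last first.
  by rewrite -cats1 -catA.
apply: IH => //; apply: subseq_uniq cu.
by rewrite -cats1 -catA cat_subseq //= eqxx; exact: suffix_subseq.
Qed.

(* The neighbours of x among the us, together with the zs, are the leaves of an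
   induced star centred at x. *)
Lemma star_bound x (zs us : seq T) :
  uniq (zs ++ us) -> all (e x) zs ->
  {in zs &, forall y z, ~~ e y z} -> {in us &, forall u v, ~~ e u v} ->
  {in us & zs, forall u z, e x u -> ~~ e z u} ->
  count (e x) us + size zs <= 4.
Proof.
move=> un xz zz uu uz; rewrite leqNgt; apply/negP => big; apply: e_star.
pose vs := zs ++ [seq u <- us | e x u]; pose ws := take 5 vs.
have vu : uniq vs.
  by apply: subseq_uniq un; rewrite cat_subseq // filter_subseq.
have svs : 4 < size vs by rewrite size_cat size_filter addnC.
have wv y : y \in ws -> y \in vs by exact: mem_take.
exists x, [set y in ws]; split; last split.
- by rewrite cardsE (card_uniqP (take_uniq 5 vu)) size_takel.
- move=> y; rewrite inE => /wv; rewrite mem_cat mem_filter.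
  by case/orP=> [/(allP xz)|/andP[]].
move=> y z; rewrite !inE => /wv + /wv; rewrite !mem_cat !mem_filter.
move=> /orP[yz|/andP[xy yu]] /orP[zz'|/andP[xz' zu]].
- exact: zz.
- exact: uz.
- by rewrite e_sym; apply: uz.
exact: uu.
Qed.

Lemma optimal_perm c1 w c2 L L' :
  perm_eq L L' -> optimal c1 w c2 L -> optimal c1 w c2 L'.
Proof. by move=> pL /andP[fr sz]; rewrite /optimal (frame_perm pL fr). Qed.

Lemma optimal_mirror5 c1 w c2 l1 l2 l3 l4 l5 :
  optimal c1 w c2 (legs5 c1 w c2 l1 l2 l3 l4 l5) ->
  optimal (rev c2) w (rev c1) (legs5 (rev c2) w (rev c1) l4 l5 l3 l1 l2).
Proof.
by case/andP=> fr sz; rewrite /optimal frame_mirror5 // !size_rev addnC.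
Qed.

Lemma optimal_swap5 c1 w c2 l1 l2 l3 l4 l5 :
  optimal c1 w c2 (legs5 c1 w c2 l1 l2 l3 l4 l5) ->
  optimal c1 w c2 (legs5 c1 w c2 l2 l1 l3 l4 l5).
Proof. by case/andP=> fr sz; rewrite /optimal frame_swap5. Qed.

Lemma optimal_swap5r c1 w c2 l1 l2 l3 l4 l5 :
  optimal c1 w c2 (legs5 c1 w c2 l1 l2 l3 l4 l5) ->
  optimal c1 w c2 (legs5 c1 w c2 l1 l2 l3 l5 l4).
Proof. by case/andP=> fr sz; rewrite /optimal frame_swap5r. Qed.

Lemma optimal_legs5 c1 w c2 L : optimal c1 w c2 L ->
  exists u1 l1 u2 l2 u3 l3 u4 l4 u5 l5,
  perm_eq L (legs5 c1 w c2 (u1 :: l1) (u2 :: l2) (u3 :: l3) (u4 :: l4) (u5 :: l5)).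
Proof.
case/andP=> fr _; have [l1 [l2 [l3 [l4 [l5 pL]]]]] := frame_legs5 fr.
have := all_legs fr; rewrite (perm_all _ pL) /=; move: pL.
case: l1 l2 l3 l4 l5 => [|u1 l1] [|u2 l2] [|u3 l3] [|u4 l4] [|u5 l5] //=; rewrite ?andbF //.
by move=> pL _; exists u1, l1, u2, l2, u3, l3, u4, l4, u5, l5.
Qed.

Lemma core_split c1 w c2 :
  exists s r, c1 ++ w :: c2 = s :: r /\ size r = size c1 + size c2.
Proof.
case: c1 => [|s c1]; first by exists w, c2.
by exists s, (c1 ++ w :: c2); rewrite size_cat /= addnS.
Qed.

Lemma sibling_nonadj c1 w c2 l1 u l2 l3 l4 l5 x :
  optimal c1 w c2 (legs5 c1 w c2 l1 (u :: l2) l3 l4 l5) -> x \in l1 -> ~~ e x u.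
Proof.
move=> /andP[fr /eqP sz] /splitPr xl; case: xl fr => a b fr; apply/negP=> xu.
by have := core_max (frame_sibling fr xu); rewrite -sz /= size_cat; lia.
Qed.

Lemma first_nonadj_third c1 w c2 l1 l2 u l3 l4 l5 x :
  optimal c1 w c2 (legs5 c1 w c2 l1 l2 (u :: l3) l4 l5) -> x \in l1 -> ~~ e x u.
Proof.
move=> /andP[fr /eqP sz] /splitPr xl; case: xl fr => a b fr; apply/negP=> xu.
have [s [r [sr szr]]] := core_split c1 w c2.
by have := core_max (frame_first_on_third fr xu sr); rewrite -sz /= szr; lia.
Qed.

Lemma third_nonadj_first c1 w c2 u l1 l2 l3 l4 l5 x :
  optimal c1 w c2 (legs5 c1 w c2 (u :: l1) l2 l3 l4 l5) -> x \in l3 -> ~~ e x u.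
Proof.
move=> /andP[fr /eqP sz] /splitPr xl; case: xl fr => a b fr; apply/negP=> xu.
have [s [r [sr szr]]] := core_split c1 w c2.
by have := core_max (frame_third_on_first fr xu sr); rewrite -sz /= szr; lia.
Qed.

(* If x on the first leg sees both leaves of the far end, then moving the part
   of the leg below x onto one of these two legs makes x a vertex of that leg
   adjacent to the leaf of its sibling. *)
Lemma first_nonadj_far c1 w c2 l1 l2 l3 u4 l4 u5 l5 x :
  optimal c1 w c2 (legs5 c1 w c2 l1 l2 l3 (u4 :: l4) (u5 :: l5)) -> x \in l1 ->
  ~~ (e x u4 && e x u5).
Proof.
move=> /andP[fr sz] /splitPr xl; case: xl fr => a b fr; apply/negP=> /andP[x4 x5].
pose L := [:: (head w c1, l2); (w, l3); (last w c2, u5 :: l5)].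
have fr' : frame m c1 w c2 ((head w c1, rcons a x ++ b) :: (last w c2, u4 :: l4) :: L).
  apply: frame_perm fr; rewrite cat_rcons; apply/permP => y; clear; rewrite /=; lia.
have {}fr' : frame m c1 w c2 (legs5 c1 w c2 b l2 l3 (rcons a x ++ u4 :: l4) (u5 :: l5)).
  by apply: frame_perm (frame_shift fr' x4); apply/permP => y; clear; rewrite /=; lia.
have /optimal_mirror5 op : optimal c1 w c2 (legs5 c1 w c2 b l2 l3 (rcons a x ++ u4 :: l4) (u5 :: l5)).
  by rewrite /optimal fr'.
have xl4 : x \in rcons a x ++ u4 :: l4 by rewrite mem_cat mem_rcons mem_head.
by have := sibling_nonadj op xl4; rewrite x5.
Qed.

Lemma first_leg_few c1 w c2 l1 u2 l2 u3 l3 u4 l4 u5 l5 x :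
  optimal c1 w c2 (legs5 c1 w c2 l1 (u2 :: l2) (u3 :: l3) (u4 :: l4) (u5 :: l5)) ->
  x \in l1 -> count (e x) [:: u2; u3; u4; u5] <= 1.
Proof.
move=> op xl; have := first_nonadj_far op xl.
rewrite /= (negPf (sibling_nonadj op xl)) (negPf (first_nonadj_third op xl)).
by case: (e x u4) (e x u5) => [] [].
Qed.

Lemma third_leg_few c1 w c2 u1 l1 u2 l2 l3 u4 l4 u5 l5 x :
  optimal c1 w c2 (legs5 c1 w c2 (u1 :: l1) (u2 :: l2) l3 (u4 :: l4) (u5 :: l5)) ->
  x \in l3 -> count (e x) [:: u1; u2; u4; u5] <= 1.
Proof.
move=> op xl; rewrite /= (negPf (third_nonadj_first op xl)).
rewrite (negPf (third_nonadj_first (optimal_swap5 op) xl)).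
have op' := optimal_mirror5 op; rewrite (negPf (third_nonadj_first op' xl)).
by rewrite (negPf (third_nonadj_first (optimal_swap5 op') xl)).
Qed.

Lemma leg_few c1 w c2 L p x : optimal c1 w c2 L -> p \in L -> x \in p.2 ->
  count (e x) (leaf_seq (rem p L)) <= 1.
Proof.
move=> op pL xp.
have [u1 [l1 [u2 [l2 [u3 [l3 [u4 [l4 [u5 [l5 pL5]]]]]]]]]] := optimal_legs5 op.
have {}op := optimal_perm pL5 op.
have rest us : perm_eq [:: u1; u2; u3; u4; u5] (leaf p :: us) ->
    count (e x) us <= 1 -> count (e x) (leaf_seq (rem p L)) <= 1.
  move=> pus; suff /permP -> : perm_eq (leaf_seq (rem p L)) us by [].
  rewrite -(perm_cons (leaf p)) -(permPr pus).
  by rewrite -(permPl (perm_map leaf (perm_to_rem pL))) (permPl (perm_map leaf pL5)).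
have op' := optimal_mirror5 op.
move: pL; rewrite (perm_mem pL5) !inE.
case/or4P=> [/eqP ep|/eqP ep|/eqP ep|/orP[]/eqP ep]; rewrite {}ep in rest xp *.
- by apply: rest _ (first_leg_few op xp); apply/permP => y; clear; rewrite /leaf_seq /= /leaf /=; lia.
- by apply: rest _ (first_leg_few (optimal_swap5 op) xp); apply/permP => y; clear; rewrite /leaf_seq /= /leaf /=; lia.
- by apply: rest _ (third_leg_few op xp); apply/permP => y; clear; rewrite /leaf_seq /= /leaf /=; lia.
- by apply: rest _ (first_leg_few op' xp); apply/permP => y; clear; rewrite /leaf_seq /= /leaf /=; lia.
by apply: rest _ (first_leg_few (optimal_swap5 op') xp); apply/permP => y; clear; rewrite /leaf_seq /= /leaf /=; lia.
Qed.

(** Regroup: [g] at each vertex is paired with [f] at the next, leaving [f] at the start and [g] at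
    the end. *)
Lemma sum_shift (f g : T -> nat) x l :
  (forall a y z b, x :: l = a ++ y :: z :: b -> f z + g y <= 1) ->
  g (last x l) = 0 -> sumn [seq f y + g y | y <- x :: l] <= f x + size l.
Proof.
elim: l x => [|z l IH] x step gl /=; first by rewrite /= in gl; lia.
have xz := step [::] x z l erefl.
have : sumn [seq f y + g y | y <- z :: l] <= f z + size l.
  by apply: IH => // a y y' b zl; apply: (step (x :: a) y y' b); rewrite zl.
rewrite /=; lia.
Qed.

Definition leaf_count L x : nat := count (e x) (leaf_seq L).

Lemma leaf_count_rem L p x : p \in L ->
  leaf_count L x = e x (leaf p) + count (e x) (leaf_seq (rem p L)).
Proof. by move=> pL; rewrite /leaf_count (permP (perm_map leaf (perm_to_rem pL))). Qed.

Lemma frame_uniq_legs c1 w c2 L : frame m c1 w c2 L -> uniq (leaf_seq L).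
Proof.
by move/frame_leaves_uniq; rewrite cat_uniq /= cat_uniq => /and5P[_ _ _ _ /andP[]].
Qed.

(* Along a leg, a vertex seeing another leaf is not followed by a neighbour of
   the leg's own leaf, and each vertex sees at most one other leaf. *)
Lemma leg_sum c1 w c2 L p : optimal c1 w c2 L -> p \in L ->
  sumn [seq leaf_count L x | x <- p.2] < size p.2.
Proof.
move=> op pL; have /andP[fr _] := op.
have uL : uniq L := map_uniq (frame_uniq_legs fr).
have := allP (all_legs fr) p pL; have few := leg_few op pL.
have remP q : q \in rem p L -> q \in L /\ p != q.
  by rewrite mem_rem_uniq // inE eq_sym => /andP[].
case: p pL few remP => a [|u l] // pL few remP _; rewrite ltnS.
rewrite (eq_map (fun x => leaf_count_rem x pL)).
pose f x : nat := e x u; pose g x := count (e x) (leaf_seq (rem (a, u :: l) L)).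
change (sumn [seq f y + g y | y <- u :: l] <= size l).
apply: leq_trans (sum_shift (f := f) (g := g) _ _) _; last by rewrite /f e_irr.
  move=> a' y z b ulE; have yl : y \in u :: l by rewrite ulE mem_cat mem_head orbT.
  have gy1 : g y <= 1 := few y yl.
  case gy: (g y) gy1 => [|[|n]] // _; first by rewrite addn0 leq_b1.
  have : 0 < g y by rewrite gy.
  rewrite -has_count => /hasP[v /mapP[q /remP[qL pq] ->] yq].
  have pL' := pL; rewrite ulE in pL' pq.
  have := leg_next fr pL' qL pq yq pL _.
  rewrite -ulE in pq; by move=> /(_ pq); rewrite /leaf /= /f => /negPf ->.
apply/eqP; rewrite -leqn0 leqNgt -has_count; apply/hasPn => v /mapP[q /remP[qL pq] ->].
by apply: (leg_end fr (a := a) (l := belast u l)); rewrite -?lastI.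
Qed.

(** * Edges from leaves to single core vertices *)

Lemma core_pair d y b w c2 L p : optimal (d ++ y :: b) w c2 L -> p \in L ->
  e y (leaf p) -> ~~ e (head w b) (leaf p).
Proof.
move=> /andP[fr /eqP sz] pL yp; apply/negP=> zp.
have fr' := frame_perm (perm_to_rem pL) fr; have /allP/(_ p pL) := all_legs fr.
case: p pL yp zp fr' => a [|u l] //= pL yp zp fr' _.
by have := core_max (frame_insert fr' yp zp); rewrite -sz !size_cat /=; lia.
Qed.

Lemma rot_left s a b w c2 u1 l1 u2 l2 u3 l3 u4 l4 u5 l5 v :
  frame m (s :: a ++ b) w c2
    (legs5 (s :: a ++ b) w c2 (u1 :: l1) (u2 :: l2) (u3 :: l3) (u4 :: l4) (u5 :: l5)) ->
  v \in [:: u1; u2] -> e (head w b) v ->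
  exists c1' R, frame m c1' w c2 ((s, rev a) :: R)
    /\ perm_eq (v :: leaf_seq R) [:: u1; u2; u3; u4; u5].
Proof.
move=> fr; rewrite !inE => /orP[]/eqP -> zv.
  do 2!eexists; split; first exact: frame_rot_first fr zv.
  exact: perm_refl.
do 2!eexists; split; first exact: frame_rot_first (frame_swap5 fr) zv.
by apply/permP => y; clear; rewrite /leaf_seq /= /leaf /=; lia.
Qed.

Lemma rot_right d y b w c2 t u1 l1 u2 l2 u3 l3 u4 l4 u5 l5 v :
  frame m (rcons d y ++ b) w (rcons c2 t)
    (legs5 (rcons d y ++ b) w (rcons c2 t)
       (u1 :: l1) (u2 :: l2) (u3 :: l3) (u4 :: l4) (u5 :: l5)) ->
  v \in [:: u3; u4; u5] -> e y v ->
  exists c1' w' c2' a R, frame m c1' w' c2' ((a, b) :: R)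
    /\ perm_eq (v :: leaf_seq R) [:: u1; u2; u3; u4; u5].
Proof.
have third c1' w' c2' k1 k2 k4 k5 us :
    frame m c1' w' c2' (legs5 c1' w' c2' k1 k2 b k4 k5) ->
    perm_eq (v :: [:: head (head w' c1') k1; head (head w' c1') k2;
                      head (last w' c2') k4; head (last w' c2') k5]) us ->
    exists c1' w' c2' a R, frame m c1' w' c2' ((a, b) :: R)
      /\ perm_eq (v :: leaf_seq R) us.
  move=> fr pv; exists c1', w', c2', w', [:: (head w' c1', k1); (head w' c1', k2); (last w' c2', k4); (last w' c2', k5)].
  by split=> //; apply: frame_perm fr; apply/permP => x; clear; rewrite /=; lia.
have fifth c1' w' c2' k1 k2 k3 k4 us :
    frame m c1' w' c2' (legs5 c1' w' c2' k1 k2 k3 k4 b) ->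
    perm_eq (v :: [:: head (head w' c1') k1; head (head w' c1') k2;
                      head w' k3; head (last w' c2') k4]) us ->
    exists c1' w' c2' a R, frame m c1' w' c2' ((a, b) :: R)
      /\ perm_eq (v :: leaf_seq R) us.
  move=> fr pv; exists c1', w', c2', (last w' c2'), [:: (head w' c1', k1); (head w' c1', k2); (w', k3); (last w' c2', k4)].
  by split=> //; apply: frame_perm fr; apply/permP => x; clear; rewrite /=; lia.
move=> fr; rewrite !inE => /or3P[]/eqP vE yv; rewrite {}vE in third fifth yv *.
- by apply: third (frame_rot_third fr yv) _; apply/permP => x; clear; rewrite /=; lia.
- by apply: fifth (frame_rot_fourth fr yv) _; apply/permP => x; clear; rewrite /=; lia.
by apply: fifth (frame_rot_fourth (frame_swap5r fr) yv) _; apply/permP => x; clear; rewrite /=; lia.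
Qed.

(** After a rotation [y] is the leaf of the segment cut off and thus independent of the remaining
    leaves; only the leaf [v] absorbed by the core needs a separate hypothesis. *)
Lemma moved_end_count c1 w c2 a y b R us v :
  frame m c1 w c2 ((a, y :: b) :: R) -> perm_eq (v :: leaf_seq R) us ->
  ~~ e y v -> count (e y) us = 0.
Proof.
move=> fr pus yv; rewrite -(permP pus) /= (negPf yv) /=; apply/eqP.
rewrite -leqn0 leqNgt -has_count; apply/hasPn => _ /mapP[q qR ->].
apply: (leaves_indep fr (p := (a, y :: b))); rewrite ?mem_head ?inE ?qR ?orbT //.
have := map_uniq (frame_uniq_legs fr); apply: contraTneq => yq.
by rewrite cons_uniq yq qR.
Qed.

Lemma leaf_countE L us x : perm_eq (leaf_seq L) us -> leaf_count L x = count (e x) us.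
Proof. by rewrite /leaf_count => /permP ->. Qed.

Lemma optimal_mirror c1 w c2 L : optimal c1 w c2 L -> optimal (rev c2) w (rev c1) L.
Proof. by case/andP=> fr sz; rewrite /optimal frame_mirror // !size_rev addnC. Qed.

Lemma leaves_indep_in c1 w c2 L : frame m c1 w c2 L ->
  {in leaf_seq L &, forall u v, ~~ e u v}.
Proof.
move=> fr _ _ /mapP[p pL ->] /mapP[q qL ->].
by have [->|pq] := eqVneq p q; [rewrite e_irr | apply: leaves_indep fr pL qL pq].
Qed.

Lemma core_pairP d y b w c2 L v : optimal (d ++ y :: b) w c2 L -> v \in leaf_seq L ->
  e y v -> ~~ e (head w b) v.
Proof. by move=> op /mapP[p pL ->]; apply: core_pair op pL. Qed.

Lemma uniq_around (A V r : seq T) x y z :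
  uniq (A ++ y :: x :: z :: r ++ V) -> uniq ([:: y; z] ++ V).
Proof.
apply: subseq_uniq; apply: subseq_trans (suffix_subseq A _).
rewrite -[y :: x :: _]/([:: y; x; z] ++ (r ++ V)); apply: cat_subseq; last exact: suffix_subseq.
exact: (mask_subseq [:: true; false; true] [:: y; x; z]).
Qed.

(** Three leaves seen by [x] and its two core neighbours would form an induced K_{1,5}: [core_pair]
    separates these neighbours from the leaves, and [frame_link], through two of the leaves, from
    each other. *)
Lemma inner_count d y x b w c2 L : optimal (rcons d y ++ x :: b) w c2 L ->
  leaf_count L x <= 2.
Proof.
move=> op; have /andP[fr _] := op; have [sc _ _ _ _] := and5P fr.
set z := head w b; have [r bE] : exists r, b ++ w :: c2 = z :: r.
  by rewrite /z; case: (b) => [|? ?]; eexists.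
rewrite -catA cat_rcons sorted_mid /= bE /= in sc; case/and4P: sc => _ yx xz _.
have yN v : v \in leaf_seq L -> e x v -> ~~ e y v.
  move=> vL; apply: contraL; rewrite cat_rcons in op; exact: core_pairP op vL.
have zN v : v \in leaf_seq L -> e x v -> ~~ e z v by exact: core_pairP op.
rewrite leqNgt; apply/negP => big.
have yz : ~~ e y z.
  have : 1 < size [seq p <- L | e x (leaf p)].
    by rewrite size_filter; apply: ltnW; move: big; rewrite /leaf_count /leaf_seq count_map.
  case E: [seq p <- L | e x (leaf p)] => [|p [|q F]] // _.
  have [xp pL] : e x (leaf p) /\ p \in L.
    by apply/andP; rewrite -(mem_filter (fun p => e x (leaf p))) E mem_head.
  have [xq qL] : e x (leaf q) /\ q \in L.
    by apply/andP; rewrite -(mem_filter (fun p => e x (leaf p))) E !inE eqxx orbT.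
  have pq : p != q.
    have := filter_uniq (fun p => e x (leaf p)) (map_uniq (frame_uniq_legs fr)).
    by rewrite E /= inE negb_or => /andP[/andP[]].
  have [l [l' [L' [pl ql _ fr']]]] := frame_two fr pL qL pq.
  apply/negP=> eyz; case: p q pl ql xp xq fr' {pL qL pq E} => a k [a' k'] /= -> -> xp xq fr'.
  by have /all_legs := frame_link fr' eyz xp xq.
suff : count (e x) (leaf_seq L) + size [:: y; z] <= 4 by rewrite /= -/(leaf_count L x); lia.
apply: star_bound.
- have := frame_leaves_uniq fr.
  have -> : (rcons d y ++ x :: b) ++ w :: c2 ++ leaf_seq L = d ++ y :: x :: z :: r ++ leaf_seq L.
    by rewrite -[z :: r ++ _]/((z :: r) ++ _) -bE cat_rcons -!catA.
  exact: uniq_around.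
- by rewrite /= e_sym yx xz.
- move=> v v'; rewrite !inE => /orP[]/eqP-> /orP[]/eqP->; rewrite ?e_irr //.
  by rewrite e_sym.
- exact: leaves_indep_in fr.
by move=> u v uL; rewrite !inE => /orP[]/eqP-> xu; [apply: yN | apply: zN].
Qed.

Lemma end_count s C w c2 L : optimal (s :: C) w c2 L -> leaf_count L s <= 3.
Proof.
move=> op; have /andP[fr _] := op; have [sc _ _ _ _] := and5P fr.
set z := head w C; have [r bE] : exists r, C ++ w :: c2 = z :: r.
  by rewrite /z; case: (C) => [|? ?]; eexists.
have sz : e s z by move: sc; rewrite /= bE => /andP[].
suff : count (e s) (leaf_seq L) + size [:: z] <= 4 by rewrite /= -/(leaf_count L s); lia.
apply: star_bound.
- have := frame_leaves_uniq fr; apply: subseq_uniq.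
  have -> : (s :: C) ++ w :: c2 ++ leaf_seq L = [:: s; z] ++ r ++ leaf_seq L.
    by rewrite -[[:: s; z] ++ _]/(s :: (z :: r) ++ leaf_seq L) -bE -!catA.
  by apply: cat_subseq; [exact: suffix_subseq [:: s] _ | exact: suffix_subseq].
- by rewrite /= sz.
- by move=> v v'; rewrite !inE => /eqP-> /eqP->; rewrite e_irr.
- exact: leaves_indep_in fr.
move=> u v uL; rewrite inE => /eqP->; exact: (core_pairP (d := [::]) op).
Qed.

Lemma lone_count w L : optimal [::] w [::] L -> leaf_count L w <= 4.
Proof.
move=> /andP[fr _]; have := @star_bound w [::] (leaf_seq L); rewrite addn0; apply=> //.
  exact: frame_uniq_legs fr.
exact: leaves_indep_in fr.
Qed.

Lemma bypass_contra d y w z c2 u1 l1 u2 l2 l3 u4 l4 u5 l5 v :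
  frame m (rcons d y) w (z :: c2)
    (legs5 (rcons d y) w (z :: c2) (u1 :: l1) (u2 :: l2) l3 (u4 :: l4) (u5 :: l5)) ->
  v \in [:: u1; u2; u4; u5] -> e w v -> ~~ e y z.
Proof.
move=> fr vU wv; apply/negP => yz.
have fr' := frame_mirror5 fr; rewrite rev_cons rev_rcons in fr'.
have zy : e z y by rewrite e_sym.
move: vU wv; rewrite !inE => /or4P[]/eqP-> wv.
- by have /all_legs := frame_bypass fr yz wv; rewrite /= !andbF.
- by have /all_legs := frame_bypass (frame_swap5 fr) yz wv; rewrite /= !andbF.
- by have /all_legs := frame_bypass fr' zy wv; rewrite /= !andbF.
by have /all_legs := frame_bypass (frame_swap5 fr') zy wv; rewrite /= !andbF.
Qed.

Lemma third_end_nonadj c1 w z c2 l1 l2 l v l4 l5 :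
  optimal c1 w (z :: c2) (legs5 c1 w (z :: c2) l1 l2 (rcons l v) l4 l5) -> ~~ e v z.
Proof.
move=> /andP[fr /eqP sz]; apply/negP => vz.
by have := core_max (frame_extend_third fr vz); rewrite size_rcons /= in sz *; lia.
Qed.

(* If w sees a leaf off its own leg, then its two core neighbours and the end of
   its leg are pairwise non-adjacent, which leaves room for only one such leaf. *)
Lemma middle_count d y w z c2 u1 l1 u2 l2 u3 l3 u4 l4 u5 l5 :
  optimal (rcons d y) w (z :: c2)
    (legs5 (rcons d y) w (z :: c2) (u1 :: l1) (u2 :: l2) (u3 :: l3) (u4 :: l4) (u5 :: l5)) ->
  count (e w) [:: u1; u2; u4; u5] <= 1.
Proof.
move=> op; have /andP[fr _] := op; have [sc _ p3 _ _] := frameP fr.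
case: (posnP (count (e w) [:: u1; u2; u4; u5])) => [->//|].
rewrite -has_count => /hasP[g gU wg].
have yz := bypass_contra fr gU wg.
have op' := optimal_mirror5 op; rewrite rev_cons rev_rcons in op'.
have /andP[fr' _] := op'.
have uU := frame_leaves_uniq fr.
have [l [v l3E]] : exists l v, u3 :: l3 = rcons l v.
  by exists (belast u3 l3), (last u3 l3); rewrite -lastI.
rewrite l3E in op op' fr fr' p3.
have vz := third_end_nonadj op; have vy := third_end_nonadj op'.
have inU u : u \in [:: u1; u2; u4; u5] -> u \in [:: u1; u2; u3; u4; u5].
  by rewrite !inE => /or4P[]/eqP->; rewrite eqxx ?orbT.
have leavesE : leaf_seq (legs5 (rcons d y) w (z :: c2) (u1 :: l1) (u2 :: l2) (rcons l v) (u4 :: l4) (u5 :: l5)) = [:: u1; u2; u3; u4; u5].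
  by rewrite -l3E.
have yN u : u \in [:: u1; u2; u4; u5] -> e w u -> ~~ e y u.
  move=> /inU uL; apply: contraL => yu; rewrite -cats1 in op.
  by apply: (core_pairP op) yu; rewrite cats1 leavesE.
have zN u : u \in [:: u1; u2; u4; u5] -> e w u -> ~~ e z u.
  move=> /inU uL; apply: contraL => zu; rewrite -cats1 in op'.
  apply: (core_pairP op') zu; rewrite -[_ \in _]/(u \in [:: u4; u5; head w (rcons l v); u1; u2]) -l3E.
  by move: uL; rewrite !inE /= => /or4P[|||/orP[]] /eqP->; rewrite eqxx ?orbT.
have u3N : u3 \notin [:: u1; u2; u4; u5].
  have : uniq [:: u3; u1; u2; u4; u5].
    rewrite (perm_uniq (s2 := [:: u1; u2; u3; u4; u5])) -?leavesE ?(frame_uniq_legs fr) //.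
    by rewrite leavesE; apply/permP => a; clear; rewrite /=; lia.
  by rewrite cons_uniq => /andP[].
have vN u : u \in [:: u1; u2; u4; u5] -> ~~ e v u.
  move=> uU'; have : u \in leaf_seq (legs5 (rcons d y) w (z :: c2) (u1 :: l1) (u2 :: l2) (rcons l v) (u4 :: l4) (u5 :: l5)).
    by rewrite leavesE inU.
  case/mapP=> q qL uq; rewrite uq; apply: (leg_end fr (a := w) (l := l)) => //.
    by rewrite !inE eqxx !orbT.
  apply: contraTneq uU' => pq; suff -> : u = u3 by [].
  by rewrite uq -pq -l3E.
have ss : subseq [:: u1; u2; u4; u5] [:: u1; u2; u3; u4; u5].
  exact: (mask_subseq [:: true; true; false; true; true] [:: u1; u2; u3; u4; u5]).
have [sd [wz yw]] : sorted e (rcons d y) /\ e w z /\ e y w.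
  by move: sc; rewrite cat_rcons sorted_mid /= => /and4P[-> -> ->].
have vw : e v w by move: p3; rewrite -cats1 cat_rcons sorted_mid /= andbT => /andP[].
suff : count (e w) [:: u1; u2; u4; u5] + size [:: y; z; v] <= 1 + 3 by rewrite leq_add2r.
apply: star_bound.
- have [_ _ _ u _] := and5P fr.
  rewrite (perm_uniq (s2 := [:: y; z] ++ [:: u1] ++ [:: u2] ++ [:: v] ++ [:: u4] ++ [:: u5])).
    apply: subseq_uniq u; apply: cat_subseq.
      rewrite cat_rcons; apply: subseq_trans (suffix_subseq d _).
      exact: (@cat_subseq _ [:: y] [:: z] [:: y; w] (z :: c2)) (prefix_subseq _ _) (prefix_subseq _ _).
    set F := flatten _.
    have -> : F = (u1 :: l1) ++ (u2 :: l2) ++ rcons l v ++ (u4 :: l4) ++ (u5 :: l5).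
      by rewrite /F /= cats0.
    by do 4?[apply: cat_subseq]; rewrite sub1seq ?mem_rcons mem_head.
  by apply/permP => a; clear; rewrite /=; lia.
- by rewrite /= e_sym yw wz e_sym vw.
- move=> a b; rewrite !inE => /or3P[]/eqP-> /or3P[]/eqP->; rewrite ?e_irr //; by rewrite e_sym.
- move=> a b aU bU; apply: (leaves_indep_in fr); rewrite leavesE; exact: inU.
move=> u a uU'; rewrite !inE => /or3P[]/eqP-> wu; [exact: yN|exact: zN|exact: vN].
Qed.

(** * Near and far leaves on one side of the core *)

Section SideCounts.

Variables (s : T) (C : seq T) (w : T) (c2 : seq T).
Variables (u1 u2 u3 u4 u5 : T) (l1 l2 l3 l4 l5 : seq T).

Let L := legs5 (s :: C) w c2 (u1 :: l1) (u2 :: l2) (u3 :: l3) (u4 :: l4) (u5 :: l5).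

Hypothesis opt : optimal (s :: C) w c2 L.

(** The split follows the direction of the rotation: a chord to a leaf at [s] cuts off the core
    segment towards [s], a chord to any other leaf the segment towards [w]. *)
Definition near x := count (e x) [:: u1; u2].
Definition far x := count (e x) [:: u3; u4; u5].

Lemma near_far x : near x + far x = leaf_count L x.
Proof. by rewrite /near /far -count_cat. Qed.

Lemma leg_of_leaf v : v \in [:: u1; u2; u3; u4; u5] -> exists2 p, p \in L & v = leaf p.
Proof. by move=> vU; apply/mapP. Qed.

Lemma core_pair_leaf d y b v : s :: C = d ++ y :: b -> v \in [:: u1; u2; u3; u4; u5] ->
  e y v -> ~~ e (head w b) v.
Proof.
move=> CE /leg_of_leaf[p pL ->]; apply: (core_pair (d := d) _ pL).
by have := opt; rewrite {1}CE; apply.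
Qed.

Lemma near_pred a z b : C = a ++ z :: b -> 0 < near z ->
  exists a' y, a = rcons a' y /\ near y + far y = 0.
Proof.
move=> CE; rewrite -has_count => /hasP[v vU zv]; have /andP[fr _] := opt.
rewrite /L CE in fr; have [c1' [R [fr' pR]]] := rot_left (b := z :: b) fr vU zv.
have := all_legs fr'; case/lastP: a CE fr' {fr} => // a y CE; rewrite rev_rcons => fr' _.
exists a, y; split=> //; rewrite near_far.
apply: moved_end_count fr' pR _; apply: contraTN zv => yv.
apply: (core_pair_leaf (d := s :: a) (y := y) (b := z :: b)) yv.
  by rewrite CE cat_rcons.
by move: vU; rewrite !inE => /orP[]/eqP->; rewrite eqxx ?orbT.
Qed.

Lemma far_next c2' t d y b : c2 = rcons c2' t -> s :: C = d ++ y :: b -> 0 < far y ->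
  exists z b', b = z :: b' /\ near z + far z = 0.
Proof.
move=> c2E CE; rewrite -has_count => /hasP[v vU yv]; have /andP[fr _] := opt.
rewrite -cat_rcons in CE; rewrite /L c2E CE in fr.
have [c1' [w' [c2'' [a [R [fr' pR]]]]]] := rot_right fr vU yv.
have := all_legs fr'; case: b CE fr' {fr} => // z b CE fr' _; exists z, b; split=> //.
rewrite near_far; apply: moved_end_count fr' pR _.
rewrite cat_rcons in CE; apply: (core_pair_leaf CE) yv.
by move: vU; rewrite !inE => /or3P[]/eqP->; rewrite eqxx ?orbT.
Qed.

Lemma far_uniq x : uniq [:: u1; u2; u3; u4; u5] -> (exists v, {in [:: u3; u4; u5], forall u, e x u -> u = v}) ->
  far x <= 1.
Proof.
move=> uU [v xv]; rewrite /far (eq_in_count (a2 := fun u => (u == v) && e x u)).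
  apply: leq_trans (sub_count (a2 := pred1 v) _ _) _; first by move=> y /andP[].
  by rewrite count_uniq_mem ?leq_b1 //; move: uU => /= /and3P[].
by move=> u uU' /=; case xu: (e x u); rewrite ?andbF // (xv u) ?eqxx.
Qed.

(** Rotating at [x] turns the rest of the segment before [w] into a leg through [y] and [z]. Then
    [leg_next] at [y] leaves only [v], absorbed by the core, as a far leaf that [z] may see. *)
Lemma near_far_next c2' t d x b y z b' : c2 = rcons c2' t ->
  s :: C = d ++ x :: b ++ y :: z :: b' -> 0 < far x -> 0 < near y -> far z <= 1.
Proof.
move=> c2E CE; rewrite -!has_count => /hasP[v vU xv] /hasP[g gU yg].
have /andP[fr _] := opt; have uU := frame_uniq_legs fr.
apply: far_uniq => //; exists v => u uU' zu; apply/eqP; apply: contraTT zu => uv.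
rewrite -cat_rcons in CE; rewrite /L c2E CE in fr.
have [c1' [w' [c2'' [a [R [fr' pR]]]]]] := rot_right fr vU xv.
have inR h : h \in [:: u1; u2; u3; u4; u5] -> h != v -> exists2 q, q \in R & h = leaf q.
  by move=> hU hv; apply/mapP; move: hU; rewrite -(perm_mem pR) inE (negPf hv).
have gv : g != v.
  apply: contraTneq uU => gv; move: vU gU; rewrite -{}gv !inE /=.
  by case/or3P=> /eqP-> /orP[]/eqP->; rewrite !inE !eqxx ?orbT ?andbF.
have [q qR gq] : exists2 q, q \in R & g = leaf q.
  by apply: inR gv; move: gU; rewrite !inE => /orP[]/eqP->; rewrite eqxx ?orbT.
have [r rR ur] : exists2 r, r \in R & u = leaf r.
  by apply: inR uv; move: uU'; rewrite !inE => /or3P[]/eqP->; rewrite eqxx ?orbT.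
have uR := map_uniq (frame_uniq_legs fr'); rewrite cons_uniq in uR; case/andP: uR => pNR uR.
rewrite ur; apply: (leg_next fr' (mem_head _ _) (q := q)).
- by rewrite inE qR orbT.
- by apply: contraNneq pNR => ->.
- by rewrite -gq.
- by rewrite inE rR orbT.
apply: contraTneq uU => rq; have {rq} : g = u by rewrite gq ur rq.
move=> gu; move: uU' gU; rewrite -{}gu !inE /=.
by case/or3P=> /eqP-> /orP[]/eqP->; rewrite !inE !eqxx ?orbT ?andbF.
Qed.

(** After the rotation at [x], [y] is the vertex of the new leg next to its anchor, so [leg_end]
    applies. *)
Lemma near_last c2' t d x b y : c2 = rcons c2' t ->
  s :: C = d ++ x :: rcons b y -> 0 < far x -> near y = 0.
Proof.
move=> c2E CE; rewrite -has_count => /hasP[v vU xv].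
have /andP[fr _] := opt; have uU := frame_uniq_legs fr.
apply/eqP; rewrite -leqn0 leqNgt -has_count; apply/hasPn => g gU.
rewrite -cat_rcons in CE; rewrite /L c2E CE in fr.
have [c1' [w' [c2'' [a [R [fr' pR]]]]]] := rot_right fr vU xv.
have gv : g != v.
  apply: contraTneq uU => gv; move: vU gU; rewrite -{}gv !inE /=.
  by case/or3P=> /eqP-> /orP[]/eqP->; rewrite !inE !eqxx ?orbT ?andbF.
have [q qR ->] : exists2 q, q \in R & g = leaf q.
  apply/mapP; have : g \in v :: leaf_seq R.
    by rewrite (perm_mem pR); move: gU; rewrite !inE => /orP[]/eqP->; rewrite eqxx ?orbT.
  by rewrite inE (negPf gv).
apply: (leg_end fr' (mem_head _ _)); first by rewrite inE qR orbT.
have := map_uniq (frame_uniq_legs fr'); rewrite cons_uniq => /andP[pNR _].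
by apply: contraNneq pNR => ->.
Qed.

End SideCounts.

(** * Summing over the whole core, then over the whole frame *)

Lemma inner_le2 s C w c2 L : optimal (s :: C) w c2 L -> {in C, forall x, leaf_count L x <= 2}.
Proof.
move=> op x /splitPr xC; case: xC op => a b op.
by apply: (@inner_count (belast s a) (last s a) x b w c2); rewrite -lastI.
Qed.

(** Only two near leaves exist, so [s] can see three leaves only if one is far; then [segment_sum]
    saves one unit on [C]. *)
Lemma segment_bound s C w c2 t u1 l1 u2 l2 u3 l3 u4 l4 u5 l5 :
  let L := legs5 (s :: C) w (rcons c2 t)
    (u1 :: l1) (u2 :: l2) (u3 :: l3) (u4 :: l4) (u5 :: l5) in
  optimal (s :: C) w (rcons c2 t) L ->
  leaf_count L s + sumn [seq leaf_count L x | x <- C] <= size C + 2.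
Proof.
move=> L op.
have nfE x : leaf_count L x = near u1 u2 x + far u3 u4 u5 x.
  by rewrite (@near_far s C w (rcons c2 t) u1 u2 u3 u4 u5 l1 l2 l3 l4 l5).
have s3 := end_count op.
have : sumn [seq leaf_count L x | x <- C] + (0 < far u3 u4 u5 s) <= size C.
  apply: (segment_sum nfE).
  - move=> a z b CE /(near_pred op CE)[a' [y [-> y0]]].
    by exists a', y; rewrite nfE.
  - exact: inner_le2 op.
  - move=> d y b CE /(far_next op erefl CE)[z [b' [-> z0]]].
    by exists z, b'; rewrite nfE.
  - by move=> d x b y z b' CE; exact: (near_far_next op erefl CE).
  by move=> d x b y CE; exact: (near_last op erefl CE).
have n2 : near u1 u2 s <= 2 by apply: count_size.
rewrite nfE in s3 *; lia.
Qed.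

(** Each side exceeds its length by at most one, and [w], seeing at most one leaf besides that of
    its own leg, exceeds 1 by at most one. *)
Lemma core_sum_three c1 w c2 L : c1 != [::] -> c2 != [::] -> optimal c1 w c2 L ->
  sumn [seq leaf_count L x | x <- c1 ++ w :: c2] <= size c1 + size c2 + 4.
Proof.
move=> c1N c2N op.
have [u1 [l1 [u2 [l2 [u3 [l3 [u4 [l4 [u5 [l5 pL]]]]]]]]]] := optimal_legs5 op.
have {}op := optimal_perm pL op.
have lcE x : leaf_count L x = count (e x) [:: u1; u2; u3; u4; u5].
  by apply: leaf_countE; apply: perm_map pL.
rewrite (eq_map lcE); set nu := fun x => count (e x) _.
case: c1 c1N op {pL lcE} => // s C _; case/lastP: c2 c2N => // c2 t _ op.
have sumC : nu s + sumn [seq nu x | x <- C] <= size C + 2 := segment_bound op.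
have op' := optimal_mirror5 op; rewrite rev_rcons rev_cons in op'.
have sumC2 : nu t + sumn [seq nu x | x <- c2] <= size c2 + 2.
  have nuE : nu =1 fun x => count (e x) [:: u4; u5; u3; u1; u2].
    by move=> x; rewrite /nu /=; lia.
  rewrite nuE (eq_map nuE) -[size c2]size_rev -sumn_rev -map_rev.
  exact: segment_bound op'.
have nuw : nu w <= 2.
  have : count (e w) [:: u1; u2; u4; u5] <= 1.
    move: op; rewrite [s :: C]lastI; case: (c2) => [|z c] op; exact: middle_count op.
  by rewrite /nu /=; case: (e w u3); lia.
move: sumC sumC2 nuw; rewrite /= map_cat map_cons map_rcons sumn_cat /= sumn_rcons size_rcons.
set a := nu s; set b := nu t; set c := nu w; set A := sumn _; set B := sumn _; clear; lia.
Qed.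

Lemma optimal_swap34 c1 w l1 l2 l3 l4 l5 :
  optimal c1 w [::] (legs5 c1 w [::] l1 l2 l3 l4 l5) ->
  optimal c1 w [::] (legs5 c1 w [::] l1 l2 l4 l3 l5).
Proof. by apply/optimal_perm/permP => b; clear; rewrite /=; lia. Qed.

Lemma third_any c1 w l1 l2 u3 l3 u4 l4 u5 l5 v :
  optimal c1 w [::] (legs5 c1 w [::] l1 l2 (u3 :: l3) (u4 :: l4) (u5 :: l5)) ->
  v \in [:: u3; u4; u5] ->
  exists k3 k4 k5, optimal c1 w [::] (legs5 c1 w [::] l1 l2 (v :: k3) k4 k5).
Proof.
move=> op; rewrite !inE => /or3P[]/eqP->; first by do 3!eexists; exact: op.
  by do 3!eexists; exact: optimal_swap34 op.
by do 3!eexists; exact: optimal_swap34 (optimal_swap5r op).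
Qed.

Lemma first_any c1 w c2 u1 l1 u2 l2 l3 l4 l5 v :
  optimal c1 w c2 (legs5 c1 w c2 (u1 :: l1) (u2 :: l2) l3 l4 l5) -> v \in [:: u1; u2] ->
  exists k1 k2, optimal c1 w c2 (legs5 c1 w c2 (v :: k1) k2 l3 l4 l5).
Proof.
move=> op; rewrite !inE => /orP[]/eqP->; first by do 2!eexists; exact: op.
by do 2!eexists; exact: optimal_swap5 op.
Qed.

Lemma last_count d y w L : optimal (rcons d y) w [::] L -> leaf_count L w <= 3.
Proof.
rewrite -cats1 => op; have /andP[fr _] := op; have [sc _ _ _ _] := and5P fr.
have yw : e y w by move: sc; rewrite -catA sorted_mid /= andbT => /andP[].
suff : count (e w) (leaf_seq L) + size [:: y] <= 4 by rewrite /= -/(leaf_count L w); lia.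
apply: star_bound.
- have := frame_leaves_uniq fr; apply: subseq_uniq; rewrite -catA.
  apply: subseq_trans (suffix_subseq d _).
  by apply: cat_subseq => //; exact: suffix_subseq [:: w] _.
- by rewrite /= e_sym yw.
- by move=> v v'; rewrite !inE => /eqP-> /eqP->; rewrite e_irr.
- exact: leaves_indep_in fr.
by move=> u v uL; rewrite inE => /eqP->; apply: contraL; apply: (core_pairP op).
Qed.

(* When no optimal frame has its third leg at an inner core vertex, the three
   legs at w are interchangeable, and an edge from one of their leaves into the
   core would move the anchor inside. *)
Lemma core_sum_two c1 w L :
  (forall c1' w' c2' L', optimal c1' w' c2' L' -> (c1' == [::]) || (c2' == [::])) ->
  c1 != [::] -> optimal c1 w [::] L ->
  sumn [seq leaf_count L x | x <- rcons c1 w] <= size c1 + 4.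
Proof.
move=> noA c1N op.
have [u1 [l1 [u2 [l2 [u3 [l3 [u4 [l4 [u5 [l5 pL]]]]]]]]]] := optimal_legs5 op.
have {}op := optimal_perm pL op.
have lcE x : leaf_count L x = count (e x) [:: u1; u2; u3; u4; u5].
  by apply: leaf_countE; apply: perm_map pL.
rewrite (eq_map lcE); set nu := fun x => count (e x) _.
case: c1 c1N op {pL lcE} => // s C _ op.
have nfE x : nu x = near u1 u2 x + far u3 u4 u5 x by rewrite /nu /near /far -count_cat.
have noA' a x b L' : ~~ optimal (s :: a) x (rcons b w) L'.
  by apply/negP => /noA; rewrite /= -size_eq0 size_rcons.
have szE a x b : size (s :: a) + size (rcons b w) = size (s :: a ++ x :: b) + 0.
  by rewrite /= size_cat size_rcons /=; lia.
have far0 : {in C, forall x, far u3 u4 u5 x = 0}.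
  move=> x xC; apply/eqP; rewrite -leqn0 leqNgt -has_count; apply/hasPn => v vU.
  have [k3 [k4 [k5 opv]]] := third_any op vU.
  move/splitPr: xC opv => [a b] /andP[fr sz]; apply/negP => xv.
  have /negP := noA' a x b (legs5 (s :: a) x (rcons b w) (u1 :: l1) (u2 :: l2) (rev (v :: k3)) k4 k5).
  by apply; rewrite /optimal frame_third_inside //= -(eqP sz) (szE a x b).
have s3 : nu s <= 3 := end_count op.
have w3 : nu w <= 3.
  by move: op; rewrite lastI => /last_count.
have n2 : near u1 u2 s <= 2 by apply: count_size.
rewrite map_rcons sumn_rcons /=.
(* Without a far leaf at [s] the bounds 2 at [s], [size C] on [C] and 3 at [w] suffice. With one,
   both ends may reach 3, but then [C] is nonempty and sees no leaf at all. *)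
have [fs|fs] := posnP (far u3 u4 u5 s).
  have predC a z b : C = a ++ z :: b -> 0 < near u1 u2 z ->
      exists a' y, a = rcons a' y /\ nu y = 0.
    by move=> CE /(near_pred op CE)[a' [y [-> y0]]]; exists a', y; rewrite nfE.
  have sC : sumn [seq nu x | x <- C] <= size C := sum_near nfE predC (inner_le2 op) (esym (cats0 C)) far0.
  have s2 : nu s <= 2 by rewrite nfE fs addn0.
  by apply: leq_trans (leq_add (leq_add s2 sC) w3) _; clear; lia.
have [v vU sv] : exists2 v, v \in [:: u3; u4; u5] & e s v.
  by apply/hasP; rewrite has_count.
have [k3 [k4 [k5 opv]]] := third_any op vU.
have near0 : {in C, forall x, near u1 u2 x = 0}.
  move=> x xC; apply/eqP; rewrite -leqn0 leqNgt -has_count; apply/hasPn => g gU.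
  have [k1 [k2 opg]] := first_any opv gU.
  move/splitPr: xC opg => [a b] /andP[fr sz]; apply/negP => xg.
  have /negP := noA' a x b (legs5 (s :: a) x (rcons b w) k2 (rev (v :: k3)) (rev (g :: k1)) k4 k5).
  by apply; rewrite /optimal frame_exchange_inside //= -(eqP sz) (szE a x b).
(* With [C] empty, the chord from [s] to [v] could replace the core edge from [s] to [w], and the
   third leg would become empty. *)
have C0 : C != [::].
  apply/negP => /eqP C0; move: opv; rewrite C0 => /andP[fr _].
  by have /all_legs := frame_rot_third (d := [::]) (b := [::]) fr sv.
have nu0 : {in C, nu =1 fun=> 0} by move=> x xC; rewrite nfE near0 ?far0.
have -> : sumn [seq nu x | x <- C] = 0 by rewrite ((eq_in_map _ _ _).1 nu0); elim: (C).
rewrite addn0.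
by apply: leq_trans (leq_add s3 w3) _; case: (C) C0 => // x D _; rewrite -[3 + 3]/(2 + 4) leq_add2r.
Qed.

Lemma flatten_sum (f : T -> nat) L : (forall p, p \in L -> sumn [seq f x | x <- p.2] < size p.2) ->
  sumn [seq f x | x <- flatten (unzip2 L)] + size L <= size (flatten (unzip2 L)).
Proof.
elim: L => //= p L IH few; rewrite map_cat sumn_cat size_cat.
have := few p (mem_head _ _).
have := IH (fun q qL => few q (mem_behead (s := p :: L) qL)); lia.
Qed.

(** The core exceeds its size by at most 3 and each of the five legs falls short by at least 1,
    whence 3 - 5 = -2. *)
Lemma total_bound c1 w c2 L : optimal c1 w c2 L ->
  sumn [seq leaf_count L x | x <- c1 ++ w :: c2] <= size c1 + size c2 + 4 ->
  sumn [seq leaf_count L x | x <- vertices c1 w c2 L] + 2 <= m.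
Proof.
move=> op core; have /andP[/and5P[_ pA _ _ /eqP <-] _] := op.
have /= szL := perm_size pA; rewrite size_map in szL.
have legs : sumn [seq leaf_count L x | x <- flatten (unzip2 L)] + 5
    <= size (flatten (unzip2 L)).
  by rewrite -szL; apply: flatten_sum => p pL; apply: leg_sum op pL.
rewrite /vertices map_cat sumn_cat !size_cat /=.
move: core legs; set a := sumn _; set b := sumn _; set c := size (flatten _); clear; lia.
Qed.

(** The given frame may have to be replaced: one with inner third anchor is taken if any exists,
    because [core_sum_two] relies on there being none. *)
Lemma optimal_sum c1 w c2 L : optimal c1 w c2 L ->
  exists c1' w' c2' L', optimal c1' w' c2' L' /\
    sumn [seq leaf_count L' x | x <- vertices c1' w' c2' L'] + 2 <= m.
Proof.
move=> op; have [[d1 [v [d2 [R [opv [d1N d2N]]]]]]|noA] := classic (exists d1 v d2 R,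
    optimal d1 v d2 R /\ d1 != [::] /\ d2 != [::]).
  by exists d1, v, d2, R; split=> //; apply: total_bound (core_sum_three d1N d2N opv).
have {}noA c1' w' c2' L' : optimal c1' w' c2' L' -> (c1' == [::]) || (c2' == [::]).
  move=> opv; apply/negPn/negP; rewrite negb_or => /andP[d1N d2N].
  by apply: noA; exists c1', w', c2', L'.
have two d v R : d != [::] -> optimal d v [::] R -> exists c1' w' c2' L',
    optimal c1' w' c2' L' /\
    sumn [seq leaf_count L' x | x <- vertices c1' w' c2' L'] + 2 <= m.
  move=> dN opv; exists d, v, [::], R; split=> //; apply: total_bound => //.
  by rewrite cats1 addn0; apply: core_sum_two noA dN opv.
have [c10|c1N] := eqVneq c1 [::]; have [c20|c2N] := eqVneq c2 [::].
- exists c1, w, c2, L; split=> //; apply: total_bound => //; move: op; rewrite c10 c20 => op.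
  by rewrite /= addn0; apply: lone_count op.
- move: op => /optimal_mirror; rewrite c10; apply: two.
  by rewrite -size_eq0 size_rev size_eq0.
- by move: op; rewrite c20; apply: two.
by have := noA _ _ _ _ op; rewrite (negPf c1N) (negPf c2N).
Qed.

End Maximal.

(** * From a spanning frame to a spanning tree *)

Lemma sorted_glue l l' l'' : l' != [::] ->
  sorted e (l ++ l') -> sorted e (l' ++ l'') -> sorted e (l ++ l' ++ l'').
Proof.
case: l' => // x l' _; rewrite sorted_mid => /andP[lx _].
by rewrite cat_cons sorted_mid lx.
Qed.

(* With an empty third leg, only the other four leg ends can be leaves. *)
Lemma frame_tree c1 w c2 l1 l2 l4 l5 : irreflexive e ->
  frame #|T| c1 w c2 (legs5 c1 w c2 l1 l2 [::] l4 l5) ->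
  exists F, spanning_tree e F /\ #|leaves F| <= 4.
Proof.
move=> e_irr fr; have [sc /andP[p1 p2] _ /andP[p4 p5] un] := frameP fr.
have szV : size (vertices c1 w c2 (legs5 c1 w c2 l1 l2 [::] l4 l5)) = #|T|.
  by have [_ _ _ _ /eqP] := and5P fr.
have inV x : x \in vertices c1 w c2 (legs5 c1 w c2 l1 l2 [::] l4 l5).
  have [|_ ->] := uniq_min_size un (fun y _ => mem_enum T y).
    by rewrite -cardT szV.
  by rewrite mem_enum.
(* The first and fourth legs prolong the core to a single path [A]; the second and fifth are then
   attached to it. *)
set A := l1 ++ (c1 ++ w :: c2) ++ rev l4.
set s := head w c1; set t := last w c2.
have sA : sorted e A.
  apply: sorted_glue; first by case: (c1).
    exact: sorted_core.
  rewrite -sorted_revE rev_cat revK rev_cat rev_cons cat_rcons.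
  apply: sorted_core; first by rewrite head_rev.
  by rewrite -cat_rcons -rev_cons -rev_cat sorted_revE.
have unABD : uniq (A ++ l2 ++ l5).
  rewrite -(perm_uniq (s1 := vertices c1 w c2 (legs5 c1 w c2 l1 l2 [::] l4 l5))) //.
  by rewrite /A; perm_vertices.
have inABD x : x \in A ++ l2 ++ l5.
  rewrite -(perm_mem (s1 := vertices c1 w c2 (legs5 c1 w c2 l1 l2 [::] l4 l5))) //.
  by rewrite /A; perm_vertices.
have sinA : s \in A.
  by rewrite /A /s !mem_cat; case: (c1) => [|? ?]; rewrite !inE eqxx ?orbT.
have tinA : t \in A.
  by rewrite /A /t !mem_cat -[w :: c2]cat1s mem_cat !inE; case/lastP: (c2) => [|? ?]; rewrite ?last_rcons ?mem_rcons ?inE /= eqxx ?orbT.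
have [h [A' AE]] : exists h A', A = h :: A' by case: (A) sinA => // h A' _; exists h, A'.
move: unABD; rewrite cat_uniq => /and3P[uA /hasPn dA un25].
move: un25; rewrite cat_uniq => /and3P[u2 /hasPn d2 u5].
have tr1 : tree_on e [set x in A] (path_edges h A' :|: set0).
  have -> : [set x in A] = [set h] :|: [set x in A'].
    by apply/setP => x; rewrite AE !inE.
  move: uA sA; rewrite AE /= => /andP[hN uA'] hA'.
  apply: (tree_path (tree_on1 e h)) => //; first by rewrite inE.
  by move=> x xA; rewrite inE; apply: contraNneq hN => <-.
have leg_path a l : sorted e (rcons l a) -> path e a (rev l).
  by rewrite -sorted_revE rev_rcons.
have tr2 := tree_path tr1 (p := s) (l := rev l2).
have {}tr2 : tree_on e ([set x in A] :|: [set x in rev l2])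
    (path_edges s (rev l2) :|: (path_edges h A' :|: set0)).
  apply: tr2; rewrite ?inE ?rev_uniq //; first exact: leg_path.
  by move=> x; rewrite mem_rev inE => x2; apply: dA; rewrite mem_cat x2.
have tr3 := tree_path tr2 (p := t) (l := rev l5).
set F := path_edges t (rev l5) :|: (path_edges s (rev l2) :|: (path_edges h A' :|: set0)) in tr3.
have {tr3}[sub _ con acy] : tree_on e ([set x in A] :|: [set x in rev l2] :|: [set x in rev l5]) F.
  apply: tr3; rewrite ?inE ?rev_uniq ?tinA //; first exact: leg_path.
  move=> x; rewrite mem_rev !inE mem_rev negb_or => x5; apply/andP; split.
    by apply: dA; rewrite mem_cat x5 orbT.
  exact: d2.
have setE : [set x in A] :|: [set x in rev l2] :|: [set x in rev l5] = setT.
  by apply/setP => x; move: (inABD x); rewrite !inE !mem_rev !mem_cat -!orbA => ->.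
rewrite setE in con.
exists F; split; first by split=> //; split=> // x y; apply: con; rewrite inE.
have FA : sorted (edge_rel F) A.
  rewrite AE; apply: path_edge_rel; rewrite -?AE //.
  by rewrite /F setU0; do 2!apply: subset_trans (subsetUr _ _).
have F2 : sorted (edge_rel F) (s :: rev l2).
  apply: path_edge_rel.
    rewrite /= rev_uniq u2 andbT mem_rev; apply: contraTN sinA => s2.
    by apply: dA; rewrite mem_cat s2.
  by rewrite /F setUCA; apply: subsetUl.
have F5 : sorted (edge_rel F) (t :: rev l5).
  apply: path_edge_rel; last exact: subsetUl.
  rewrite /= rev_uniq u5 andbT mem_rev; apply: contraTN tinA => t5.
  by apply: dA; rewrite mem_cat t5 orbT.
apply: leq_trans (card_size [:: head s A; last s A; last s (rev l2); last t (rev l5)]).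
apply/subset_leq_card/subsetP => v; rewrite inE => v1.
have end_of a l : uniq (a :: rev l) -> sorted (edge_rel F) (a :: rev l) -> v \in l ->
    a != v -> v = last a (rev l).
  move=> ul sl vl av; have vl' : v \in a :: rev l by rewrite inE mem_rev vl orbT.
  have /= := path_leaf a ul sl vl' v1; rewrite eq_sym (negPf av) => /eqP.
  by [].
have := inABD v; rewrite (mem_cat v A) (mem_cat v l2) => /or3P[vA|v2|v5].
- by have := path_leaf s uA FA vA v1; rewrite !inE => /orP[]->; rewrite ?orbT.
- have sv : s != v by apply: contraTneq sinA => ->; apply: dA; rewrite mem_cat v2.
  rewrite (end_of s l2) ?inE ?eqxx ?orbT //.
  rewrite /= rev_uniq u2 andbT mem_rev; apply: contraTN sinA => s2.
  by apply: dA; rewrite mem_cat s2.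
have tv : t != v by apply: contraTneq tinA => ->; apply: dA; rewrite mem_cat v5 orbT.
rewrite (end_of t l5) ?inE ?eqxx ?orbT //.
rewrite /= rev_uniq u5 andbT mem_rev; apply: contraTN tinA => t5.
by apply: dA; rewrite mem_cat t5 orbT.
Qed.

Lemma vertices_perm c1 w c2 L L' : perm_eq L L' ->
  perm_eq (vertices c1 w c2 L) (vertices c1 w c2 L').
Proof. by move=> pL; rewrite perm_cat2l perm_flatten // perm_map. Qed.

Lemma frame_size m c1 w c2 L : frame m c1 w c2 L -> m <= #|T|.
Proof.
case/and5P=> _ _ _ /card_uniqP <- /eqP <-; exact: max_card.
Qed.

Lemma frame_leaf_nbr m c1 w c2 L u q :
  (forall d1 v d2 R, frame m d1 v d2 R -> all (fun p => p.2 != [::]) R) ->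
  (forall d1 v d2 R, ~~ frame m.+1 d1 v d2 R) ->
  frame m c1 w c2 L -> u \in leaf_seq L -> e u q -> q \in vertices c1 w c2 L.
Proof.
move=> legs maxm fr /mapP[p pL uE] uq; have pR := perm_to_rem pL.
have := allP (legs _ _ _ _ fr) p pL; rewrite (perm_mem (vertices_perm c1 w c2 pR)).
have fr' := frame_perm pR fr.
case: p uE {pL pR} fr' => a [|v l] //= uE fr' _.
apply/negPn/negP => qN; have := maxm c1 w c2 ((a, [:: q, v & l]) :: rem (a, v :: l) L).
by rewrite (frame_grow_leaf fr' qN) // e_sym -[v]/(leaf (a, v :: l)) -uE.
Qed.

Lemma double_count (A B : seq T) :
  sumn [seq count (e x) A | x <- B] = \sum_(v <- A) count (e v) B.
Proof.
have cE x (D : seq T) : count (e x) D = \sum_(y <- D) e x y.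
  by rewrite -sum1_count big_mkcond; apply: eq_bigr => y _; case: (e x y).
rewrite sumnE big_map (eq_bigr _ (fun x _ => cE x A)) exchange_big.
apply: eq_bigr => v _; rewrite cE; apply: eq_bigr => x _; by rewrite e_sym.
Qed.

End Frames.

(** * The extremal choice and the final count *)

Lemma max_exists (P : nat -> Prop) M n : P n -> (forall k, P k -> k <= M) ->
  exists2 m, P m & forall k, P k -> k <= m.
Proof.
move=> + PM; have [d] := ubnP (M - n); elim: d n => // d IH n Md Pn.
have [[k [Pk nk]]|noP] := classic (exists k, P k /\ n < k).
  by have kM := PM _ Pk; apply: IH Pk; lia.
by exists n => // k Pk; rewrite leqNgt; apply/negP => nk; apply: noP; exists k.
Qed.

Lemma boundary_edge (T : finType) (e : rel T) (V : seq T) :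
  connected_graph e -> V != [::] -> size V < #|T| ->
  exists p q, [/\ p \in V, q \notin V & e p q].
Proof.
move=> con V0 Vs; apply: NNPP => no.
have clV : forall a b, e a b -> a \in V -> b \in V.
  by move=> a b ab aV; apply/negPn/negP => bV; apply: no; exists a, b.
case: V V0 Vs clV {no} => // x V _ Vs clV.
have: #|T| <= size (x :: V).
  apply: leq_trans (card_size (x :: V)); rewrite -cardsT; apply/subset_leq_card/subsetP => y _.
  exact: connect_inv clV (con x y) (mem_head _ _).
by rewrite leqNgt Vs.
Qed.

Theorem theorem1p9 (T : finType) (e : rel T) :
  simple_graph e ->
  connected_graph e ->
  star_free e 5 ->
  sigma_ge e 5 (#|T| - 1) ->
  exists F : {set {set T}}, spanning_tree e F /\ #|leaves F| <= 4.
Proof.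
move=> [e_sym e_irr] con e_star sigma; apply: NNPP => no.
(* The graph may have no vertex; the empty edge set then serves as the tree. *)
have [x0 _|T0] := pickP (@predT T); last first.
  apply: no; exists set0; split.
    by split; [move=> E; rewrite inE | split=> x; have := T0 x].
  by apply: leq_trans (max_card _) _; rewrite (eq_card0 T0).
pose framed n := exists c1 w c2 L, frame e n c1 w c2 L.
have framed1 : framed 1 by do 4!eexists; exact: frame1 e x0.
have framed_le k : framed k -> k <= #|T| by case=> c1 [w [c2 [L fr]]]; apply: frame_size fr.
have [m [c1 [w [c2 [L fr]]]] max_m] := max_exists framed1 framed_le.
have maxm d1 v d2 R : ~~ frame e m.+1 d1 v d2 R.
  by apply/negP => fr'; have := max_m m.+1; rewrite ltnn => /(_ _)/negP; apply=> //; exists d1, v, d2, R.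
have legs d1 v d2 R : frame e m d1 v d2 R -> all (fun p => p.2 != [::]) R.
  move=> frd; apply/negPn/negP; rewrite -has_predC => /hasP[p pR /negPn p0].
  have [|d3 [y [d4 [k1 [k2 [k4 [k5 frk]]]]]]] := frame_short_any e_sym frd.
    by apply/hasP; exists p.
  have /orP[/eqP mT|mT] : (m == #|T|) || (m < #|T|) by rewrite -leq_eqVlt (frame_size frk).
    by apply: no; rewrite mT in frk; apply: frame_tree frk.
  have [_ _ _ _ /eqP sz] := and5P frk.
  have [||a [b [aV bV ab]]] := boundary_edge (V := vertices d3 y d4 (legs5 d3 y d4 k1 k2 [::] k4 k5)) con.
  - by rewrite -size_eq0 /vertices !size_cat /= addnS.
  - by rewrite sz.
  rewrite e_sym in ab; have [d5 [z [d6 [R' fr']]]] := frame_grow e_sym frk aV bV ab.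
  by have := maxm d5 z d6 R'; rewrite fr'.
pose cored k := exists d1 v d2 R, frame e m d1 v d2 R /\ size d1 + size d2 = k.
have cored_le k : cored k -> k <= m.
  case=> d1 [v [d2 [R [/and5P[_ _ _ _ /eqP <-] <-]]]].
  by rewrite /vertices !size_cat /=; lia.
have [K [d1 [v [d2 [R [frR szR]]]]] max_K] :=
  max_exists (ex_intro _ c1 (ex_intro _ w (ex_intro _ c2 (ex_intro _ L (conj fr erefl))))) cored_le.
have core_max a x b A : frame e m a x b A -> size a + size b <= K.
  by move=> frA; apply: max_K; exists a, x, b, A.
have opt : optimal e m K d1 v d2 R by rewrite /optimal frR szR eqxx.
have [a [x [b [A [/andP[frA _] sumA]]]]] := optimal_sum e_sym legs e_irr e_star core_max opt.
set V := vertices a x b A in sumA *.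
have uA := frame_uniq_legs legs frA.
have [_ pA _ _ /eqP szV] := and5P frA.
have szA : size (leaf_seq A) = 5 by rewrite size_map -(size_map fst) (perm_size pA).
have indep : independent e [set u in leaf_seq A].
  by move=> u u'; rewrite !inE; apply: (leaves_indep_in e_sym legs e_irr frA).
have card5 : #|[set u in leaf_seq A]| = 5 by rewrite cardsE (card_uniqP uA).
have := sigma _ card5 indep.
(* Edges between leaves and [V] are counted from both sides; no degree is lost, since every
   neighbour of a leaf lies in [V]. *)
have : \sum_(u in [set u in leaf_seq A]) deg e u <= sumn [seq leaf_count e A y | y <- V].
  rewrite /leaf_count (double_count e_sym) big_uniq //=.
  rewrite (eq_bigl (mem (leaf_seq A))) => [|u]; last by rewrite inE.
  apply: leq_sum => u uL; rewrite /deg -size_filter.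
  apply: leq_trans (card_size _); apply/subset_leq_card/subsetP => q; rewrite inE mem_filter => uq.
  by rewrite uq; apply: (frame_leaf_nbr e_sym legs maxm frA uL uq).
(* The degree sum is at most [m - 2], hence at most [#|T| - 2], below the bound given by [sigma]. *)
have := frame_size frA; lia.
Qed.
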